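(* Let $d\ge3$ be an integer and let $$p_0=\begin{cases}(d-2)2^d+6 & \text{if } d \text{ is odd},\\ (d-1)2^d+4 & \text{if } d\text{ is even}.\end{cases}$$ If $p\ge p_0$, then for every $\varepsilon>0$ there exists a constant $C$ (independent of $N$) such that for all positive integers $N$, $$K_{d,p,N}\le C N^{\frac12-\frac{d+1}{p}+\varepsilon}.$$
   Context: Here $\mathbb T=\mathbb R/\mathbb Z$, and $K_{d,p,N}$ denotes the best (smallest) constant such that for all complex numbers $a_{-N},\dots,a_N$, $$\Big\|\sum_{n=-N}^N a_n e^{2\pi i t n^d+2\pi i x n}\Big\|_{L^p_{x,t}(\mathbb T\times\mathbb T)}\le K_{d,p,N}\Big(\sum_{n=-N}^N|a_n|^2\Big)^{1/2}.$$ *)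

(* Defs.v *)
From HB Require Import structures.
From mathcomp Require Import all_boot all_order all_algebra complex.
From mathcomp Require Import all_classical all_reals all_analysis.

Set Implicit Arguments.
Unset Strict Implicit.
Unset Printing Implicit Defensive.

Import Order.TTheory GRing.Theory Num.Theory.
Import numFieldNormedType.Exports.

Local Open Scope classical_set_scope.
Local Open Scope ring_scope.
Local Open Scope complex_scope.

(* e(u) = exp(2 pi i u) *)
Definition expi {R : realType} (u : R) : R[i] :=
  cos (2 * pi * u) +i* sin (2 * pi * u).

(* Functions on R/Z are represented by 1-periodic functions on R; the
   normalized Haar measure of R/Z is then Lebesgue measure on the fundamental
   domain [0, 1]. *)
Definition torus_measure (R : realType) : probability _ R :=
  uniform_prob (@ltr01 R).
Arguments torus_measure R : clear implicits.

Definition torus2_measure (R : realType) :=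
  (torus_measure R \x torus_measure R)%E.
Arguments torus2_measure R : clear implicits.

Definition Lnorm_torus2 {R : realType} (p : R) (f : R * R -> R[i]) : \bar R :=
  Lnorm (torus2_measure R) p%:E (fun z => (Normc.normc (f z))%:E).

(* i |-> i - N enumerates the integers -N, ..., N as i runs over 'I_(2N+1) *)
Definition freq (N : nat) (i : 'I_(N.*2.+1)) : int := i%:Z - N%:Z.

(* the point of the torus is z = (x, t) *)
Definition exp_sum {R : realType} (d N : nat) (a : int -> R[i]) (z : R * R) :
    R[i] :=
  \sum_(i < N.*2.+1) a (freq i) *
    expi (z.2 * (freq i)%:~R ^+ d + z.1 * (freq i)%:~R).

Definition l2norm {R : realType} (N : nat) (a : int -> R[i]) : R :=
  Num.sqrt (\sum_(i < N.*2.+1) Normc.normc (a (freq i)) ^+ 2).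

(* Taken in the extended reals, so that it would be +oo, and not 0, if there
   were no admissible constant. *)
Definition best_constant {R : realType} (d : nat) (p : R) (N : nat) : \bar R :=
  ereal_inf [set K%:E | K in [set K : R | forall a : int -> R[i],
    (Lnorm_torus2 p (exp_sum d N a) <= (K * l2norm N a)%:E)%E]].

Definition p0 (d : nat) : nat :=
  (if odd d then (d - 2) * 2 ^ d + 6 else (d - 1) * 2 ^ d + 4)%N.

(* Main.v *)
(* The space-time integral of |F|^p0, F being the exponential sum, is an average
   over a fine grid (Z/m)^2, because F is a trigonometric polynomial and p0 is
   even; all the estimates are made on that grid.  Normalise the mass
   A = sum |a_n|^2 to 1 and let K be the sum F with all a_n equal to 1, M = 2^(d-1).

   For a level set G = {|F|^2 >= Lam}, duality and Cauchy-Schwarz give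
     Lam |G|^2 <= sum_{z, z' in G} |K(z - z')|.
   Weyl differencing, d - 1 times, gives |K|^M <= C N^(M-d) H, where H depends on
   t only and is a sum of characters e(k t) in which k = 0 occurs O(N^(d-1)) times
   and any other k at most N^eps times, by the divisor bound.  After multiplication
   by |K|^2, every frequency (l, k) of (H - H_0) |K|^2 has multiplicity at most
   N^(1+eps), so Bessel's inequality for the indicator of G yields
     sum_{z, z' in G} (|K|^(M+2) - tau |K|^2) <= N^(M-d+1+eps) m^2 |G|,
   with tau of order N^(M-1).  Hence either Lam^M = O(N^(M-1)), or
   |G| / m^2 <= N^(M-d+1+eps) Lam^(-M-2).

   Summing the second alternative over dyadic levels is enough for p0 > 2M + 4;
   the range Lam^M = O(N^(M-1)) is covered by the fourth moment of F (d even) or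
   its sixth moment (d odd), and this is what determines the value of p0. *)

Require Import Defs.
From HB Require Import structures.
From mathcomp Require Import all_boot all_order all_algebra complex.
From mathcomp Require Import all_classical all_reals all_analysis.
From mathcomp Require Import measurable_realfun.
From mathcomp Require Import zify ring lra.

Set Implicit Arguments.
Unset Strict Implicit.
Unset Printing Implicit Defensive.

Import Order.TTheory GRing.Theory Num.Theory.
Import numFieldNormedType.Exports.

Local Open Scope classical_set_scope.
Local Open Scope ring_scope.

(** * The divisor bound *)

Section DivisorFunction.
Local Open Scope nat_scope.
(** [e.+1] is the number of divisors of p^e. The bound is the k-th power of e + 1 <= k (floor(e/k) +
    1) <= k 2^floor(e/k). *)
Lemma succ_exp_bound (k : nat) : 0 < k ->
  forall e, e.+1 ^ k <= k ^ k * 2 ^ e.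
Proof.
move=> k0 e; have h : e.+1 <= k * 2 ^ (e %/ k).
  apply: (@leq_trans (k * (e %/ k).+1)); first by rewrite mulnC ltn_ceil.
  by rewrite leq_mul2l ltn_expl ?orbT.
apply: (@leq_trans ((k * 2 ^ (e %/ k)) ^ k)); first by rewrite leq_exp2r.
rewrite expnMn leq_mul2l -expnM leq_exp2l // leq_trunc_div.
by rewrite orbT.
Qed.

Lemma size_divisors_part (p n : nat) : 0 < n ->
  size (divisors n) <= (logn p n).+1 * size (divisors n`_p^').
Proof.
move=> n0.
have -> : (logn p n).+1 * size (divisors n`_p^') =
   size [seq p ^ i * e | i <- iota 0 (logn p n).+1, e <- divisors n`_p^'].
  by rewrite size_allpairs size_iota.
apply: uniq_leq_size (divisors_uniq _) _ => e.
rewrite -dvdn_divisors // => en; have e0 := dvdn_gt0 n0 en.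
apply/allpairsP; exists (logn p e, e`_p^'); split; rewrite ?[fst _]/= ?[snd _]/=.
- by rewrite mem_iota ltnS dvdn_leq_log.
- by rewrite -dvdn_divisors ?part_gt0 // partn_dvd.
- by rewrite -p_part partnC.
Qed.

(** Prime factors are removed one at a time, from the largest down. A prime p >= 2^k costs nothing,
    since (e + 1)^k <= 2^(e k) <= p^e; a smaller one costs a factor k^k. The exponent
    [minn Q (2 ^ k)] bounds the number of small primes. *)
Lemma size_divisors_bound_smooth (k Q n : nat) : 0 < k -> 0 < n ->
  (forall p, prime p -> p %| n -> p < Q) ->
  size (divisors n) ^ k <= (k ^ k) ^ minn Q (2 ^ k) * n.
Proof.
move=> k0; have kk0 : 0 < k ^ k by rewrite expn_gt0 k0.
elim: Q n => [|Q IH] n n0 hn.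
  have [n1|] := leqP n 1; last by move/pdiv_prime/hn => /(_ (pdiv_dvd _)).
  by rewrite (_ : n = 1) ?min0n ?exp1n //; lia.
have [/andP[pQ Qn]|nQ] := boolP (prime Q && (Q %| n)); last first.
  apply: (@leq_trans ((k ^ k) ^ minn Q (2 ^ k) * n)).
    apply: IH => // p pp pn; have := hn p pp pn; rewrite ltnS leq_eqVlt.
    by case: eqP => // pQ; rewrite -pQ pp pn in nQ.
  by rewrite leq_mul2r leq_pexp2l ?orbT // leq_min !geq_min leqnn leqnSn orbT.
have n'0 : 0 < n`_Q^' by apply: part_gt0.
have {}IH : size (divisors n`_Q^') ^ k <= (k ^ k) ^ minn Q (2 ^ k) * n`_Q^'.
  apply: IH => // p pp pn.
  have := hn p pp (dvdn_trans pn (dvdn_part _ _)); rewrite ltnS leq_eqVlt.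
  case: eqP => // pQ'; move: pn; rewrite pQ' => Qn'.
  have /(pnatP _ n'0) /(_ Q pQ Qn') := part_pnat Q^' n.
  by rewrite inE /= inE eqxx.
set e := logn Q n.
have nE : n = Q ^ e * n`_Q^' by rewrite -p_part partnC.
apply: (@leq_trans ((e.+1 * size (divisors n`_Q^')) ^ k)).
  by rewrite leq_exp2r // size_divisors_part.
rewrite expnMn [X in _ <= _ * X]nE.
have Q2 := prime_gt1 pQ.
have [QK|KQ] := ltnP Q (2 ^ k).
  rewrite (_ : minn Q.+1 _ = Q.+1); last by apply/minn_idPl.
  rewrite (_ : minn Q _ = Q) in IH; last by apply/minn_idPl; exact: ltnW.
  rewrite expnS.
  apply: (@leq_trans ((k ^ k * 2 ^ e) * ((k ^ k) ^ Q * n`_Q^'))).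
    by apply: leq_mul => //; exact: succ_exp_bound.
  rewrite mulnACA !leq_mul //.
  by case: (e) => // e'; rewrite leq_exp2r.
rewrite (_ : minn Q.+1 _ = 2 ^ k); last by apply/minn_idPr; lia.
rewrite (_ : minn Q _ = 2 ^ k) in IH; last exact/minn_idPr.
rewrite mulnCA; apply: leq_mul => //.
apply: (@leq_trans ((2 ^ e) ^ k)); first by rewrite leq_exp2r // ltn_expl.
by rewrite -expnM mulnC expnM; case: (e) => // e'; rewrite leq_exp2r.
Qed.

Lemma size_divisors_bound (k : nat) : 0 < k ->
  exists2 C, 0 < C & forall n, 0 < n -> size (divisors n) ^ k <= C * n.
Proof.
move=> k0; exists ((k ^ k) ^ (2 ^ k)); first by rewrite !expn_gt0 k0.
move=> n n0; apply: leq_trans (size_divisors_bound_smooth (Q := n.+1) k0 n0 _) _.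
  by move=> p _ /(dvdn_leq n0).
by rewrite leq_mul2r leq_pexp2l ?orbT ?geq_minr // expn_gt0 k0.
Qed.

End DivisorFunction.
Lemma size_zdivisors (k : int) (s : seq int) : k != 0 -> uniq s ->
  (forall h, h \in s -> (h %| k)%Z) -> (size s <= (size (divisors `|k|%N)).*2)%N.
Proof.
move=> k0 us hs.
set D := divisors _.
have -> : ((size D).*2 = size ([seq x%:Z | x <- D] ++ [seq - x%:Z | x <- D]))%N.
  by rewrite size_cat !size_map addnn.
apply: uniq_leq_size us _ => h /hs; rewrite dvdzE.
rewrite dvdn_divisors ?absz_gt0 // => hD.
rewrite mem_cat; case: (ger0P h) => h0.
  by rewrite -[h]gez0_abs // map_f.
have hE : h = - (`|h|%N : int) by rewrite ltz0_abs ?opprK.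
by rewrite {2}hE (map_f (fun x : nat => - x%:Z)) // orbT.
Qed.

(** * Weyl differencing *)

(* Locked, since simplification would otherwise peel off the first element. *)
Definition zrange (N : nat) : seq int :=
  locked [seq i%:Z - N%:Z | i <- iota 0 N.*2.+1].

Lemma mem_zrange N n : (n \in zrange N) = (`|n| <= N)%N.
Proof.
rewrite /zrange -lock; apply/mapP/idP => [ [k + ->]|nN]; first by rewrite mem_iota; lia.
by exists (absz (n + N%:Z)); rewrite ?mem_iota; lia.
Qed.

Lemma uniq_zrange N : uniq (zrange N).
Proof. by rewrite /zrange -lock map_inj_uniq ?iota_uniq // => i j; lia. Qed.

Lemma size_zrange N : size (zrange N) = N.*2.+1.
Proof. by rewrite /zrange -lock size_map size_iota. Qed.

Lemma big_subset_supp (V : nmodType) (T : eqType) (s t : seq T) (u : T -> V) :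
  uniq s -> uniq t -> {subset t <= s} ->
  (forall x, x \notin t -> u x = 0) -> \sum_(x <- s) u x = \sum_(x <- t) u x.
Proof.
move=> us ut ts u0.
rewrite (bigID (mem t)) /= [X in _ + X]big1 ?addr0; last by move=> x; exact: u0.
rewrite -big_filter; apply: perm_big; apply: uniq_perm => //.
  exact: filter_uniq.
by move=> x; rewrite mem_filter /=; apply/andb_idr/ts.
Qed.

(** Differences of two points of [-N, N] lie in [-2N, 2N], so shifts in the doubled range reach
    every k; the points n + h outside [-N, N] contribute zero. *)
Lemma sum_zrange_shift (V : nmodType) N n (u : int -> V) :
  n \in zrange N -> (forall k, k \notin zrange N -> u k = 0) ->
  \sum_(h <- zrange N.*2) u (n + h) = \sum_(k <- zrange N) u k.
Proof.
move=> nN u0; rewrite -(big_map (fun h => n + h) xpredT u).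
apply: big_subset_supp u0.
- by rewrite map_inj_uniq ?uniq_zrange //; exact: addrI.
- exact: uniq_zrange.
- move=> k; rewrite !mem_zrange => kN; apply/mapP; exists (k - n); last by lia.
  by move: nN; rewrite !mem_zrange; lia.
Qed.

Section Differencing.
Variable C : numClosedFieldType.
Implicit Types x y : C.

Lemma CauchySchwarz_sum (T : eqType) (s : seq T) (a b : T -> C) :
  `|\sum_(i <- s) a i * b i| ^+ 2
    <= (\sum_(i <- s) `|a i| ^+ 2) * (\sum_(i <- s) `|b i| ^+ 2).
Proof.
have h : (\sum_(i <- s) `|a i| * `|b i|) ^+ 2
    <= (\sum_(i <- s) `|a i| ^+ 2) * (\sum_(i <- s) `|b i| ^+ 2).
  rewrite -subr_ge0 -(pmulr_lge0 _ (ltr0n C 2)).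
  (* Lagrange's identity: the defect in Cauchy-Schwarz is half a sum of squares. *)
  suff <- : \sum_(i <- s) \sum_(j <- s) (`|a i| * `|b j| - `|a j| * `|b i|) ^+ 2 =
    ((\sum_(i <- s) `|a i| ^+ 2) * (\sum_(i <- s) `|b i| ^+ 2)
     - (\sum_(i <- s) `|a i| * `|b i|) ^+ 2) * 2.
    apply: sumr_ge0 => i _; apply: sumr_ge0 => j _.
    by rewrite real_exprn_even_ge0 // rpredB // rpredM // normr_real.
  have sqE (x y z t : C) : (x * t - z * y) ^+ 2 =
      x ^+ 2 * t ^+ 2 + y ^+ 2 * z ^+ 2 - (x * y * (z * t)) *+ 2 by ring.
  under eq_bigr do under eq_bigr do rewrite sqE.
  under eq_bigr do rewrite sumrB big_split /= -!mulr_sumr sumrMnl -mulr_sumr.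
  rewrite sumrB big_split /= -!mulr_suml sumrMnl -mulr_suml.
  ring.
have S0 : 0 <= \sum_(i <- s) `|a i| * `|b i|.
  by apply: sumr_ge0 => i _; rewrite mulr_ge0.
apply: le_trans h; rewrite lerXn2r ?nnegrE //.
by apply: le_trans (ler_norm_sum _ _ _) _; under eq_bigr do rewrite normrM.
Qed.

Lemma sqr_sum_le (T : eqType) (s : seq T) (f : T -> C) :
  (forall i, 0 <= f i) ->
  (\sum_(i <- s) f i) ^+ 2 <= (size s)%:R * \sum_(i <- s) f i ^+ 2.
Proof.
move=> f0; have := CauchySchwarz_sum s (fun=> 1) f.
under eq_bigr do rewrite mul1r.
rewrite ger0_norm ?sumr_ge0 // => /le_trans; apply.
under eq_bigr do rewrite normr1 expr1n.
rewrite big_const_seq count_predT iter_addr_0.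
by under eq_bigr do rewrite ger0_norm //.
Qed.

(** The power mean inequality for the exponent 2^j, by j applications of Cauchy-Schwarz. *)
Lemma expr2n_sum_le (T : eqType) (s : seq T) (f : T -> C) j :
  (forall i, 0 <= f i) ->
  (\sum_(i <- s) f i) ^+ (2 ^ j)
    <= (size s)%:R ^+ (2 ^ j - 1) * \sum_(i <- s) f i ^+ (2 ^ j).
Proof.
elim: j f => [|j IH] f f0.
  by rewrite expn0 subnn expr0 mul1r expr1; under [X in _ <= X]eq_bigr do rewrite expr1.
rewrite expnS exprM.
apply: (@le_trans _ _ (((size s)%:R * \sum_(i <- s) f i ^+ 2) ^+ (2 ^ j))).
  rewrite lerXn2r ?nnegrE ?exprn_ge0 ?mulr_ge0 ?sumr_ge0 ?sqr_sum_le //.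
  by move=> i _; rewrite exprn_ge0.
rewrite exprMn.
have IHf : (\sum_(i <- s) f i ^+ 2) ^+ (2 ^ j) <=
    (size s)%:R ^+ (2 ^ j - 1) * \sum_(i <- s) (f i ^+ 2) ^+ (2 ^ j).
  by apply: IH => i; rewrite exprn_ge0.
apply: le_trans (ler_wpM2l _ IHf) _; first by rewrite exprn_ge0.
rewrite mulrA -exprD; under eq_bigr do rewrite -exprM.
rewrite (_ : (2 ^ j + (2 ^ j - 1) = 2 * 2 ^ j - 1)%N) //.
by have := ltn_expl j (isT : (1 < 2)%N); lia.
Qed.

Definition zdiff (h : int) (u : int -> C) (n : int) : C := u (n + h) * (u n)^*.

Fixpoint Wsum (N j : nat) (u : int -> C) : C :=
  if j is j'.+1 then \sum_(h <- zrange N.*2) Wsum N j' (zdiff h u)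
  else \sum_(n <- zrange N) u n.

(** Opening the square gives exactly the sum over h of the differenced sums, so the first
    differencing costs nothing. In the inductive step the power mean inequality costs
    (4N+1)^(2^(j+1) - 1), and the induction hypothesis applies for each h. *)
Lemma Weyl_differencing N j (u : int -> C) :
  (forall k, k \notin zrange N -> u k = 0) ->
  `|\sum_(n <- zrange N) u n| ^+ (2 ^ j.+1)
     <= (N.*2.*2.+1)%:R ^+ (2 ^ j.+1 - j.+2) * Wsum N j.+1 u.
Proof.
elim: j u => [|j IH] u u0.
all: have sqE : `|\sum_(n <- zrange N) u n| ^+ 2 =
  \sum_(h <- zrange N.*2) \sum_(n <- zrange N) zdiff h u n.
1,3: rewrite normCK rmorph_sum /= mulr_sumr exchange_big /= big_seq [RHS]big_seq.
1,2: apply: eq_bigr => n nN; rewrite /zdiff -mulr_suml sum_zrange_shift //.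
  by rewrite expn1 subnn expr0 mul1r sqE.
rewrite expnS exprM sqE.
have W0 : 0 <= \sum_(h <- zrange N.*2) `|\sum_(n <- zrange N) zdiff h u n|.
  by rewrite sumr_ge0.
have S0 : 0 <= \sum_(h <- zrange N.*2) \sum_(n <- zrange N) zdiff h u n.
  by rewrite -sqE exprn_ge0.
apply: (@le_trans _ _ ((\sum_(h <- zrange N.*2) `|\sum_(n <- zrange N) zdiff h u n|)
   ^+ (2 ^ j.+1))).
  rewrite lerXn2r ?nnegrE //.
  by rewrite -(ger0_norm S0); exact: ler_norm_sum.
apply: le_trans (expr2n_sum_le _ _ _) _ => //.
rewrite size_zrange.
apply: (@le_trans _ _ ((N.*2.*2.+1)%:R ^+ (2 ^ j.+1 - 1) *
   \sum_(h <- zrange N.*2)  (N.*2.*2.+1)%:R ^+ (2 ^ j.+1 - j.+2) * Wsum N j.+1 (zdiff h u))).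
  rewrite ler_wpM2l ?exprn_ge0 //; apply: ler_sum => h _.
  apply: IH => k kN; by rewrite /zdiff (u0 k) // rmorph0 mulr0.
rewrite -mulr_sumr mulrA -exprD.
rewrite (_ : (2 ^ j.+1 - 1 + (2 ^ j.+1 - j.+2) = 2 * 2 ^ j.+1 - j.+3)%N) //.
by have := ltn_expl j.+1 (isT : (1 < 2)%N); lia.
Qed.

End Differencing.

(* [freqs N j S f] lists the phases of the j-fold differenced sum of e(f(n)),
   where S records that n and all its shifts stay in the original range. *)
Definition fdiff (h : int) (f : int -> int) (n : int) : int := f (n + h) - f n.
Definition sdiff (h : int) (S : pred int) : pred int := [pred n | S n & S (n + h)].

Fixpoint freqs (N j : nat) (S : pred int) (f : int -> int) : seq int :=
  if j is j'.+1
  then flatten [seq freqs N j' (sdiff h S) (fdiff h f) | h <- zrange N.*2]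
  else [seq f n | n <- zrange N & S n].

Lemma freqsS N j S f : freqs N j.+1 S f =
  flatten [seq freqs N j (sdiff h S) (fdiff h f) | h <- zrange N.*2].
Proof. by []. Qed.

(** Taylor expansion at x. After division by [h] the degree has dropped by one and the top
    coefficient is multiplied by the old degree, hence stays nonzero over the integers. *)
Lemma horner_diff (R : comNzRingType) (p : {poly R}) j (h : R) :
  (size p <= j.+2)%N ->
  exists q : {poly R}, [/\ (size q <= j.+1)%N, q`_j = p`_j.+1 *+ j.+1
    & forall x, p.[x + h] - p.[x] = h * q.[x]].
Proof.
move=> sp; exists (\sum_(i < j.+1) (h ^+ i *: p^`N(i.+1))); split.
- apply/leq_sizeP => k jk; rewrite coef_sum big1 // => i _.
  by rewrite coefZ coef_nderivn nth_default ?mul0rn ?mulr0 //; apply: leq_trans sp _; lia.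
- rewrite coef_sum big_ord_recl big1 ?addr0 => [|i _].
    by rewrite coefZ coef_nderivn expr0 mul1r add1n bin1.
  by rewrite coefZ coef_nderivn nth_default ?mul0rn ?mulr0 //=;
    apply: leq_trans sp _; rewrite /bump; lia.
- move=> x; rewrite (nderiv_taylor_wide (mulrC _ _) sp) big_ord_recl.
  rewrite nderivn0 expr0 mulr1 addrAC subrr add0r horner_sum mulr_sumr.
  apply: eq_bigr => i _; rewrite hornerZ /= /bump add1n exprS; ring.
Qed.

Lemma dvdz_freqs N j S f (h k : int) : (forall n, (h %| f n)%Z) ->
  k \in freqs N j S f -> (h %| k)%Z.
Proof.
elim: j S f => [|j IH] S f hf; first by case/mapP => n _ ->.
rewrite freqsS; case/flattenP => s /mapP[g _ ->]; apply: IH => n.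
by rewrite /fdiff rpredB.
Qed.

Lemma freqs_bounded N j (S : pred int) f (B : nat) k :
  (forall n, S n -> (absz (f n) <= B)%N) ->
  k \in freqs N j S f -> (absz k <= 2 ^ j * B)%N.
Proof.
elim: j S f B => [|j IH] S f B hB.
  by case/mapP => n; rewrite mem_filter => /andP[Sn nN] ->; rewrite mul1n hB.
rewrite freqsS; case/flattenP => s /mapP[h _ ->] ks; rewrite expnSr -mulnA.
apply: IH ks => n /andP[/hB + /hB]; rewrite /fdiff; lia.
Qed.

Lemma size_freqs N j S f : (size (freqs N j S f) <= N.*2.*2.+1 ^ j.+1)%N.
Proof.
elim: j S f => [|j IH] S f.
  rewrite /freqs size_map expn1; apply: (@leq_trans N.*2.+1); last lia.
  by rewrite -size_zrange size_filter count_size.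
rewrite freqsS size_flatten /shape -map_comp sumnE big_map expnS.
apply: (@leq_trans (\sum_(h <- zrange N.*2) N.*2.*2.+1 ^ j.+1)%N).
  by apply: leq_sum => h _; exact: IH.
by rewrite big_const_seq count_predT iter_addn_0 size_zrange mulnC.
Qed.

Lemma count_freqs_lin N S f (p : {poly int}) k : (size p <= 2)%N -> p`_1 != 0 ->
  f =1 horner p -> (count_mem k (freqs N 0 S f) <= 1)%N.
Proof.
move=> sp p1 fp; rewrite count_uniq_mem ?leq_b1 // map_inj_in_uniq.
  by rewrite filter_uniq // uniq_zrange.
move=> x y _ _; rewrite !fp !(horner_coef_wide _ sp) !big_ord_recl !big_ord0 /=.
by rewrite !expr0 !mulr1 !addr0 !expr1 => /addrI /(mulfI p1).
Qed.

Lemma fdiff_horner f (p : {poly int}) j h : f =1 horner p ->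
  (size p <= j.+2)%N -> p`_j.+1 != 0 -> h != 0 ->
  exists2 q : {poly int}, fdiff h f =1 horner q &
    (size q <= j.+1)%N /\ q`_j != 0.
Proof.
move=> fp sp p0 h0; have [q [sq qj qE]] := horner_diff h sp.
exists (h *: q); first by move=> n; rewrite hornerZ -qE /fdiff !fp.
split; first by apply: leq_trans (size_scale_leq _ _) _.
by rewrite coefZ mulf_neq0 // qj mulrn_eq0.
Qed.

Lemma dvdz_fdiff f (p : {poly int}) h n : f =1 horner p -> (h %| fdiff h f n)%Z.
Proof.
move=> fp; have [//|q [_ _ qE]] := @horner_diff _ p (size p) h.
  by rewrite -addn2 leq_addr.
by rewrite /fdiff !fp qE dvdz_mulr.
Qed.

Lemma count_flatten_map (T T' : eqType) (s : seq T) (F : T -> seq T') k :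
  count_mem k (flatten (map F s)) = (\sum_(h <- s) count_mem k (F h))%N.
Proof. by rewrite count_flatten -map_comp sumnE big_map. Qed.

(** Each shift divides every phase derived from its difference, so a nonzero k leaves at most [D]
    choices for each of the j shifts, all nonzero. The remaining phase is linear in n with nonzero
    slope and determines n. *)
Lemma count_freqs_neq0 N j S f (p : {poly int}) (D B : nat) k :
  (forall k : int, k != 0 -> (absz k <= B)%N ->
     ((size (divisors (absz k))).*2 <= D)%N) ->
  k != 0 -> (absz k <= B)%N ->
  f =1 horner p -> (size p <= j.+2)%N -> p`_j.+1 != 0 ->
  (count_mem k (freqs N j S f) <= D ^ j)%N.
Proof.
move=> hD k0 kB; elim: j S f p => [|j IH] S f p fp sp p0.
  by rewrite expn0; exact: count_freqs_lin sp p0 fp.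
rewrite freqsS count_flatten_map.
apply: (@leq_trans (\sum_(h <- zrange N.*2 | (h %| k)%Z) D ^ j)%N).
  rewrite [X in (_ <= X)%N]big_mkcond; apply: leq_sum => h _.
  have [->|h0] := eqVneq h 0.
    rewrite dvd0z (negbTE k0) leqn0.
    apply/eqP/count_memPn/negP => kf.
    suff : (0 %| k)%Z by rewrite dvd0z (negbTE k0).
    by apply: dvdz_freqs kf => n; exact: dvdz_fdiff fp.
  case: ifPn => [_|/negP hk].
    by have [q fq [sq q0]] := fdiff_horner fp sp p0 h0; exact: IH fq sq q0.
  rewrite leqn0; apply/eqP/count_memPn/negP => kf; apply: hk.
  by apply: dvdz_freqs kf => n; exact: dvdz_fdiff fp.
rewrite big_const_seq iter_addn_0 mulnC expnS leq_mul2r; apply/orP; right.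
rewrite -size_filter; apply: leq_trans (hD k k0 kB).
apply: size_zdivisors => //; first by rewrite filter_uniq // uniq_zrange.
by move=> h; rewrite mem_filter => /andP[].
Qed.

(** The differenced phase is the product of the j shifts and a factor linear in n. It vanishes only
    if a shift is 0 or n is the root of that factor: j + 1 events, each removing one factor 4N + 1
    from the count. *)
Lemma count_freqs_eq0 N j S f (p : {poly int}) :
  f =1 horner p -> (size p <= j.+2)%N -> p`_j.+1 != 0 ->
  (count_mem (0 : int) (freqs N j S f) <= j.+1 * N.*2.*2.+1 ^ j)%N.
Proof.
elim: j S f p => [|j IH] S f p fp sp p0.
  by rewrite expn0; exact: count_freqs_lin sp p0 fp.
rewrite freqsS count_flatten_map.
have z0 : 0 \in zrange N.*2 by rewrite mem_zrange.
rewrite (bigD1_seq 0) ?uniq_zrange //= mulSn.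
apply: leq_add; first exact: leq_trans (count_size _ _) (size_freqs _ _ _ _).
apply: (@leq_trans (\sum_(h <- zrange N.*2) j.+1 * N.*2.*2.+1 ^ j)%N).
  rewrite big_mkcond; apply: leq_sum => h _; case: ifP => // h0.
  by have [q fq [sq q0]] := fdiff_horner fp sp p0 h0; exact: IH fq sq q0.
by rewrite big_const_seq count_predT iter_addn_0 size_zrange expnS mulnAC mulnA.
Qed.

(** * Differenced sums of unimodular characters *)

Section DifferencedCharacters.
Variable C : numClosedFieldType.

Lemma eq_Wsum N j (u v : int -> C) : u =1 v -> Wsum N j u = Wsum N j v.
Proof.
elim: j u v => [|j IH] u v uv /=; first exact: eq_bigr.
by apply: eq_bigr => h _; apply: IH => n; rewrite /zdiff !uv.
Qed.

Variable w : C.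
Hypothesis w1 : `|w| = 1.

Lemma w_neq0 : w != 0. Proof. by rewrite -normr_eq0 w1 oner_neq0. Qed.

Lemma norm_expz k : `|w ^ k| = 1.
Proof.
by case: k => n; rewrite ?NegzE ?exprnN ?normrV ?normrX ?w1 ?expr1n ?invr1 ?unitfE
  ?expf_neq0 ?w_neq0.
Qed.

Lemma conj_expz k : (w ^ k)^* = w ^ (- k).
Proof.
rewrite fmorphXz -exprz_inv; congr (_ ^ k).
by apply: (mulfI w_neq0); rewrite -normCK w1 expr1n mulfV // w_neq0.
Qed.

Lemma sqr_norm_sum_expz (T : eqType) (s : seq T) (f : T -> int) (b : T -> C) :
  `|\sum_(i <- s) b i * w ^ f i| ^+ 2 =
  \sum_(i <- s) \sum_(j <- s) b i * (b j)^* * w ^ (f i - f j).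
Proof.
rewrite normCK rmorph_sum mulr_suml; apply: eq_bigr => i _.
rewrite mulr_sumr; apply: eq_bigr => j _.
by rewrite rmorphM /= conj_expz expfzDr ?w_neq0 // mulrACA.
Qed.

Lemma zdiff_expz (S : pred int) (f : int -> int) h n :
  zdiff h (fun n => (S n)%:R * w ^ f n) n = (sdiff h S n)%:R * w ^ fdiff h f n.
Proof.
rewrite /zdiff rmorphM /= rmorph_nat conj_expz mulrACA -natrM mulnb andbC.
by rewrite -expfzDr ?w_neq0.
Qed.

Lemma Wsum_freqs N j (S : pred int) f (t : int) :
  Wsum N j (fun n => (S n)%:R * w ^ (f n * t)) =
  \sum_(k <- freqs N j S f) w ^ (k * t).
Proof.
elim: j S f => [|j IH] S f.
  rewrite [RHS]big_map big_filter [RHS]big_mkcond; apply: eq_bigr => n _.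
  by case: (S n); rewrite ?mul1r ?mul0r.
rewrite freqsS big_flatten big_map; apply: eq_bigr => h _.
rewrite -IH; apply: eq_Wsum => n.
by rewrite zdiff_expz /fdiff mulrBl.
Qed.

Lemma zdiff2_expz (S : pred int) (f : int -> int) h h' n :
  zdiff h' (zdiff h (fun n => (S n)%:R * w ^ f n)) n =
  (sdiff h' (sdiff h S) n)%:R * w ^ fdiff h' (fdiff h f) n.
Proof. by rewrite -zdiff_expz /zdiff -!zdiff_expz. Qed.

(** The first difference turns n x into the constant phase h x and the second removes it, so x
    disappears. With d - 1 differences this asks for d >= 3. *)
Lemma Wsum_freqs_linear N j (S : pred int) f (x t : int) :
  Wsum N j.+2 (fun n => (S n)%:R * w ^ (n * x + f n * t)) =
  \sum_(k <- freqs N j.+2 S f) w ^ (k * t).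
Proof.
rewrite -Wsum_freqs; apply: eq_bigr => h _; apply: eq_bigr => h' _.
apply: eq_Wsum => n; rewrite !zdiff2_expz; congr (_ * w ^ _).
rewrite /fdiff; ring.
Qed.

End DifferencedCharacters.

(** * Plancherel and Bessel on the grid *)

Section Plancherel.
Variables (C : numClosedFieldType) (m : nat) (w : C).
Hypothesis mw : m.-primitive_root w.
Let m0 : (0 < m)%N := prim_order_gt0 mw.

Lemma norm_prim_root : `|w| = 1.
Proof.
apply/eqP; rewrite -(@pexpr_eq1 _ _ m) //.
by rewrite -normrX (prim_expr_order mw) normr1.
Qed.
Let w1 := norm_prim_root.
Let wn0 : w != 0 := w_neq0 w1.

Lemma prim_expz_eq1 (k : int) : (w ^ k == 1) = (m %| k)%Z.
Proof.
case: k => n; first by rewrite -exprnP -(prim_order_dvd mw).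
rewrite NegzE -exprnN invr_eq1 -(prim_order_dvd mw).
by rewrite dvdzE abszN absz_nat.
Qed.

Lemma eq_prim_expz (k l : int) : (m %| k - l)%Z -> w ^ k = w ^ l.
Proof.
rewrite -prim_expz_eq1 expfzDr // => /eqP h.
by rewrite -[RHS]mul1r -h -mulrA -expfzDr // addNr expr0z mulr1.
Qed.

Lemma sum_prim_expz (k : int) :
  \sum_(x < m) w ^ (k * x%:Z) = if (m %| k)%Z then m%:R else 0.
Proof.
under eq_bigr do rewrite -exprz_exp -exprnP.
rewrite -prim_expz_eq1; case: (eqVneq (w ^ k) 1) => [->|h].
  by under eq_bigr do rewrite expr1n; rewrite sumr_const card_ord.
have h1 : w ^ k - 1 != 0 by rewrite subr_eq0.
apply: (mulfI h1).
rewrite -subrX1 mulr0 exprnP exprz_exp mulrC -exprz_exp -exprnP.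
by rewrite (prim_expr_order mw) exp1rz subrr.
Qed.

Definition pairing (y z : int * int) : int := y.1 * z.1 + y.2 * z.2.
Definition gpt (z : 'I_m * 'I_m) : int * int := ((z.1 : nat)%:Z, (z.2 : nat)%:Z).

Lemma pairingC y z : pairing y z = pairing z y.
Proof. by rewrite /pairing [y.1 * _]mulrC [y.2 * _]mulrC. Qed.

Lemma ord_congr (i j : 'I_m) : (m %| i%:Z - j%:Z)%Z = (i == j).
Proof.
apply/idP/eqP => [|->]; last by rewrite subrr dvdz0.
move=> h; apply: val_inj => /=; apply/eqP; rewrite -eqz_nat.
have := h; rewrite -eqz_mod_dvd !modz_nat !modn_small ?ltn_ord //.
Qed.

Lemma Plancherel (g : 'I_m * 'I_m -> C) :
  \sum_y `|\sum_z g z * w ^ pairing (gpt y) (gpt z)| ^+ 2 =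
  m%:R ^+ 2 * \sum_z `|g z| ^+ 2.
Proof.
under eq_bigr do rewrite sqr_norm_sum_expz //.
rewrite exchange_big mulr_sumr; apply: eq_bigr => z _.
rewrite exchange_big (bigD1 z) //= [X in _ + X]big1 ?addr0 => [|z' zz'].
  under eq_bigr do rewrite subrr expr0z mulr1.
  by rewrite sumr_const card_prod card_ord -normCK -[LHS]mulr_natl natrM expr2.
rewrite -mulr_sumr; apply/eqP; rewrite mulf_eq0; apply/orP; right; apply/eqP.
transitivity ((\sum_(x < m) w ^ (((z.1 : nat)%:Z - (z'.1 : nat)%:Z) * x%:Z)) *
  (\sum_(x < m) w ^ (((z.2 : nat)%:Z - (z'.2 : nat)%:Z) * x%:Z))).
  rewrite mulr_suml -(pair_bigA _ (fun x t : 'I_m =>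
     w ^ (pairing (gpt (x, t)) (gpt z) - pairing (gpt (x, t)) (gpt z')))) /=.
  apply: eq_bigr => x _; rewrite mulr_sumr; apply: eq_bigr => t _.
  rewrite -expfzDr //; congr (w ^ _); rewrite /pairing /=; ring.
rewrite !sum_prim_expz !ord_congr.
case: eqP => [e1|]; last by rewrite mul0r.
case: eqP => [e2|]; last by rewrite mulr0.
by case/eqP: zz'; rewrite [z]surjective_pairing e1 e2 -surjective_pairing.
Qed.

Definition zclass (k : int) : 'I_m := Ordinal (ltn_pmod (absz (k %% m)%Z) m0).

Lemma zclassE (k : int) : (zclass k)%:Z = (k %% m)%Z.
Proof.
have := ltz_pmod k (_ : (0 < m%:Z)); have := @modz_ge0 k m.
rewrite /= => h1 h2; rewrite modn_small; lia.
Qed.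

Definition class2 (y : int * int) := (zclass y.1, zclass y.2).

Lemma expz_pairing_class y z :
  w ^ pairing (gpt (class2 y)) z = w ^ pairing y z.
Proof.
apply: eq_prim_expz; rewrite /pairing /gpt /=.
rewrite [_ - _](_ : _ = ((zclass y.1)%:Z - y.1) * z.1 + ((zclass y.2)%:Z - y.2) * z.2);
  last by ring.
by apply: rpredD; apply: dvdz_mulr; rewrite zclassE -eqz_mod_dvd modz_mod.
Qed.

Definition in_box (B : nat) (y : int * int) := (absz y.1 <= B)%N && (absz y.2 <= B)%N.

Lemma class2_inj B y y' : (B.*2 < m)%N -> in_box B y -> in_box B y' ->
  class2 y = class2 y' -> y = y'.
Proof.
have inj (k l : int) : (absz k <= B)%N -> (absz l <= B)%N -> (B.*2 < m)%N ->
    zclass k = zclass l -> k = l.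
  move=> kB lB Bm /(congr1 (fun i : 'I_m => i%:Z)); rewrite !zclassE => /eqP.
  rewrite eqz_mod_dvd dvdzE absz_nat => h.
  apply/eqP; rewrite -subr_eq0 -absz_eq0; apply/eqP.
  by case: (posnP (absz (k - l))) => // /dvdn_leq /(_ h); lia.
case: y y' => [k l] [k' l'] Bm /andP[/= y1 y2] /andP[/= y1' y2'].
by move=> e; rewrite (inj _ _ y1 y1' Bm (congr1 fst e)) (inj _ _ y2 y2' Bm (congr1 snd e)).
Qed.

Lemma count_class2 (T : eqType) (s : seq T) (f : T -> int * int) (B D : nat) c :
  (B.*2 < m)%N -> (forall i, i \in s -> in_box B (f i)) ->
  (forall y, in_box B y -> (count (fun i => f i == y) s <= D)%N) ->
  (count (fun i => class2 (f i) == c) s <= D)%N.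
Proof.
move=> Bm hB hD.
have [/hasP[i0 si0 /eqP <-]|] := boolP (has (fun i => class2 (f i) == c) s); last first.
  by rewrite has_count -leqNgt leqn0 => /eqP ->.
apply: leq_trans (hD (f i0) (hB _ si0)).
rewrite (@eq_in_count _ _ (fun i => f i == f i0)) // => i si.
by apply/eqP/eqP => [|-> //]; exact: class2_inj Bm (hB _ si) (hB _ si0).
Qed.

(** As 2B < m, distinct frequencies of the box stay distinct modulo m, so a residue class receives
    at most [D] entries of the list; Plancherel sums over all classes. *)
Lemma Bessel (T : eqType) (s : seq T) (f : T -> int * int) (B D : nat)
    (g : 'I_m * 'I_m -> C) :
  (B.*2 < m)%N -> (forall i, i \in s -> in_box B (f i)) ->
  (forall y, in_box B y -> (count (fun i => f i == y) s <= D)%N) ->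
  \sum_(i <- s) `|\sum_z g z * w ^ pairing (f i) (gpt z)| ^+ 2 <=
  D%:R * (m%:R ^+ 2 * \sum_z `|g z| ^+ 2).
Proof.
move=> Bm hB hD; rewrite -Plancherel mulr_sumr.
rewrite (partition_big (fun i => class2 (f i)) xpredT) //=.
apply: ler_sum => c _.
rewrite (eq_bigr (fun=> `|\sum_z g z * w ^ pairing (gpt c) (gpt z)| ^+ 2)).
  rewrite big_const_seq iter_addr_0 -[X in X <= _]mulr_natl.
  by rewrite ler_wpM2r ?exprn_ge0 // ler_nat; exact: count_class2 hB hD.
move=> i /eqP <-; congr (`| _ | ^+ 2).
by apply: eq_bigr => z _; rewrite expz_pairing_class.
Qed.

(** Coefficients whose frequencies agree modulo m are merged before Plancherel is applied. A merged
    coefficient has at most [D] terms, so Cauchy-Schwarz costs a factor [D]. *)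
Lemma dual_Bessel (T : eqType) (s : seq T) (f : T -> int * int) (B D : nat)
    (b : T -> C) :
  (B.*2 < m)%N -> (forall i, i \in s -> in_box B (f i)) ->
  (forall y, in_box B y -> (count (fun i => f i == y) s <= D)%N) ->
  \sum_z `|\sum_(i <- s) b i * w ^ pairing (f i) (gpt z)| ^+ 2 <=
  D%:R * (m%:R ^+ 2 * \sum_(i <- s) `|b i| ^+ 2).
Proof.
move=> Bm hB hD.
pose F c := \sum_(i <- s | class2 (f i) == c) b i.
have -> : \sum_z `|\sum_(i <- s) b i * w ^ pairing (f i) (gpt z)| ^+ 2 =
    \sum_z `|\sum_c F c * w ^ pairing (gpt z) (gpt c)| ^+ 2.
  apply: eq_bigr => z _; congr (`| _ | ^+ 2).
  rewrite (partition_big (fun i => class2 (f i)) xpredT) //=.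
  apply: eq_bigr => c _; rewrite /F mulr_suml; apply: eq_bigr => i /eqP <-.
  by rewrite -expz_pairing_class pairingC.
rewrite Plancherel mulrCA ler_wpM2l ?exprn_ge0 //.
rewrite (partition_big (fun i => class2 (f i)) xpredT) //= mulr_sumr.
apply: ler_sum => c _; rewrite /F -!(big_filter s (fun i => class2 (f i) == c)).
set s' := seq.filter _ _.
apply: (@le_trans _ _ ((size s')%:R * \sum_(i <- s') `|b i| ^+ 2)).
  apply: (@le_trans _ _ ((\sum_(i <- s') `|b i|) ^+ 2)).
    by rewrite lerXn2r ?nnegrE ?sumr_ge0 //; exact: ler_norm_sum.
  exact: sqr_sum_le.
rewrite ler_wpM2r //; first by apply: sumr_ge0 => i _; rewrite exprn_ge0.
by rewrite ler_nat size_filter; exact: count_class2 hB hD.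
Qed.

End Plancherel.

(** * Level sets *)

Definition curve (d : nat) (n : int) : int * int := (n, n ^+ d).
Definition zsub (z z' : int * int) : int * int := (z.1 - z'.1, z.2 - z'.2).

Lemma pairing_zsub y z z' : pairing y (zsub z z') = pairing y z - pairing y z'.
Proof. rewrite /pairing /zsub /=; ring. Qed.

Definition curve_freqs (d N : nat) : seq int :=
  freqs N d.-1 (fun n => n \in zrange N) (fun n => n ^+ d).

Lemma horner_Xn_int d : (fun n : int => n ^+ d) =1 horner 'X^d.
Proof. by move=> n; rewrite hornerXn. Qed.

Lemma count0_curve_freqs d N : (0 < d)%N ->
  (count_mem (0 : int) (curve_freqs d N) <= d * N.*2.*2.+1 ^ d.-1)%N.
Proof.
case: d => // d _; apply: count_freqs_eq0 (horner_Xn_int _) _ _.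
  by rewrite size_polyXn.
by rewrite coefXn eqxx.
Qed.

Lemma curve_freqs_bounded d N k : k \in curve_freqs d N ->
  (absz k <= 2 ^ d.-1 * N ^ d)%N.
Proof.
apply: freqs_bounded => n; rewrite mem_zrange abszX => nN.
by case: (d) => // d'; rewrite leq_exp2r.
Qed.

(** The doubling accounts for divisors of both signs. [B] will be (4N)^d, a box that holds the
    frequencies of all the sums below. *)
Definition divisor_bound (B D : nat) :=
  forall k : int, k != 0 -> (absz k <= B)%N ->
    ((size (divisors (absz k))).*2 <= D)%N.

Lemma count_curve_freqs d N D k : (0 < d)%N -> divisor_bound ((4 * N) ^ d) D ->
  k != 0 -> (count_mem k (curve_freqs d N) <= D ^ d.-1)%N.
Proof.
case: d => // d _ hD k0.
have [kB|kB] := leqP (absz k) ((4 * N) ^ d.+1).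
  apply: count_freqs_neq0 hD k0 kB (horner_Xn_int _) _ _.
    by rewrite size_polyXn.
  by rewrite coefXn eqxx.
rewrite leqNgt -[X in (X < _)%N]/(D ^ d)%N; apply/negP => h.
have : k \in curve_freqs d.+1 N by rewrite -has_pred1 has_count (leq_ltn_trans _ h).
move/curve_freqs_bounded => /=; apply/negP; rewrite -ltnNge.
apply: leq_ltn_trans kB; rewrite expnMn leq_mul2r; apply/orP; right.
by apply: (@leq_trans (2 ^ d.+1)); rewrite ?leq_exp2l // leq_exp2r.
Qed.

(** * Weyl's inequality and the energy of a set *)

Section WeylSum.
Variables (C : numClosedFieldType) (m : nat) (w : C).
Hypothesis mw : m.-primitive_root w.
Let w1 : `|w| = 1 := norm_prim_root mw.
Let wn0 : w != 0 := w_neq0 w1.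
Local Notation pt := ('I_m * 'I_m)%type.

Definition Weyl_sum d N (z : int * int) : C :=
  \sum_(n <- zrange N) w ^ pairing (curve d n) z.

Lemma Weyl_inequality d N z : (2 < d)%N ->
  `|Weyl_sum d N z| ^+ (2 ^ d.-1) <=
    N.*2.*2.+1%:R ^+ (2 ^ d.-1 - d) * \sum_(k <- curve_freqs d N) w ^ (k * z.2).
Proof.
case: d => [|[|[|j]]] //= _.
pose u n : C := (n \in zrange N)%:R * w ^ (n * z.1 + n ^+ j.+3 * z.2).
have -> : Weyl_sum j.+3 N z = \sum_(n <- zrange N) u n.
  by rewrite /Weyl_sum big_seq [RHS]big_seq; apply: eq_bigr => n nN; rewrite /u nN mul1r.
apply: le_trans (Weyl_differencing _ _) _.
  by move=> k /negbTE kN; rewrite /u kN mul0r.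
by rewrite Wsum_freqs_linear.
Qed.

Lemma Weyl_sum_sqr d N z : `|Weyl_sum d N z| ^+ 2 =
  \sum_(n <- zrange N) \sum_(n' <- zrange N) w ^ pairing (zsub (curve d n) (curve d n')) z.
Proof.
have := sqr_norm_sum_expz w1 (zrange N) (fun n => pairing (curve d n) z) (fun=> 1).
under eq_bigr do rewrite mul1r; move=> ->.
apply: eq_bigr => n _; apply: eq_bigr => n' _.
by rewrite rmorph1 !mul1r ![pairing _ z]pairingC pairing_zsub.
Qed.

(** A character of z - z' factors, so the energy of a single frequency is a square, to which
    Bessel's inequality applies. *)
Lemma energy_freq (g : pt -> C) y :
  \sum_z \sum_z' g z * (g z')^* * w ^ pairing y (zsub (gpt z) (gpt z')) =
  `|\sum_z g z * w ^ pairing y (gpt z)| ^+ 2.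
Proof.
rewrite sqr_norm_sum_expz //; apply: eq_bigr => z _; apply: eq_bigr => z' _.
by rewrite pairing_zsub.
Qed.

(* Keeping the factor |K|^2 is what retains the x variable: the frequencies of the
   differenced sum alone involve t only. *)
Lemma energy_bound d N D (G : pred pt) : (2 < d)%N -> (0 < N)%N ->
  divisor_bound ((4 * N) ^ d) D -> (((4 * N) ^ d).*2 < m)%N -> 
  \sum_(z in G) \sum_(z' in G)
    (`|Weyl_sum d N (zsub (gpt z) (gpt z'))| ^+ (2 ^ d.-1).+2 -
     (N.*2.*2.+1 ^ (2 ^ d.-1 - d) * (d * N.*2.*2.+1 ^ d.-1))%:R *
       `|Weyl_sum d N (zsub (gpt z) (gpt z'))| ^+ 2)
  <= (N.*2.*2.+1 ^ (2 ^ d.-1 - d) * (N.*2.+1 * D ^ d.-1))%:R * m%:R ^+ 2 * #|G|%:R.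
Proof.
move=> d2 N0 hD Bm.
set q := N.*2.*2.+1; set M := (2 ^ d.-1)%N; set K := Weyl_sum d N.
pose L' := [seq k <- curve_freqs d N | k != 0].
pose H' (t : int) := \sum_(k <- L') w ^ (k * t).
have d0 : (0 < d)%N by lia.
(* Weyl's inequality multiplied by |K|^2. The zero phases of H are counted and moved to the left as
   tau |K|^2; [H'] is the remainder H - H_0. *)
have pointwise z : `|K z| ^+ M.+2 - (q ^ (M - d) * (d * q ^ d.-1))%:R * `|K z| ^+ 2
    <= q%:R ^+ (M - d) * (H' z.2 * `|K z| ^+ 2).
  rewrite -addn2 exprD -mulrBl mulrA ler_wpM2r ?exprn_ge0 //.
  rewrite lerBlDr; apply: le_trans (Weyl_inequality N z d2) _.
  rewrite natrM natrX -mulrDr ler_wpM2l ?exprn_ge0 //.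
  rewrite (bigID (fun k => k != 0)) /= -big_filter -/L' -/(H' _) lerD2l.
  rewrite (eq_bigr (fun=> 1)); last by move=> k /negPn/eqP ->; rewrite mul0r expr0z.
  rewrite big_const_seq iter_addr_0 -[1 *+ _]/(_%:R) ler_nat.
  apply: leq_trans (count0_curve_freqs N d0).
  by apply: sub_count => k; rewrite negbK.
have -> : #|G|%:R = \sum_z `|(z \in G)%:R : C| ^+ 2.
  rewrite -sum1_card natr_sum big_mkcond; apply: eq_bigr => z _.
  by case: (z \in G); rewrite ?normr1 ?normr0 ?expr1n ?expr0n.
set g : pt -> C := fun z => (z \in G)%:R.
apply: (@le_trans _ _ (\sum_z \sum_z' g z * (g z')^* *
  (q%:R ^+ (M - d) * (H' (zsub (gpt z) (gpt z')).2 * `|K (zsub (gpt z) (gpt z'))| ^+ 2)))).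
  rewrite big_mkcond; apply: ler_sum => z _; rewrite /g.
  case: (z \in G); last by rewrite big1 // => z' _; rewrite !mul0r.
  rewrite big_mkcond; apply: ler_sum => z' _.
  by case: (z' \in G); rewrite rmorph_nat ?mulr0 ?mul0r // !mul1r; exact: pointwise.
(* For fixed n', the product of [H'] and |K|^2 has the frequency (n - n', k + n^d - n'^d) for each
   pair (n, k). *)
have expand z : H' z.2 * `|K z| ^+ 2 = \sum_(n' <- zrange N)
   \sum_(i <- [seq (n, k) | n <- zrange N, k <- L'])
     w ^ pairing (i.1 - n', i.2 + i.1 ^+ d - n' ^+ d) z.
  rewrite Weyl_sum_sqr exchange_big mulr_sumr; apply: eq_bigr => n' _.
  rewrite big_allpairs mulr_sumr; apply: eq_bigr => n _.
  rewrite mulr_suml; apply: eq_bigr => k _; rewrite -expfzDr //; congr (w ^ _).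
  rewrite /pairing /zsub /=; ring.
have -> : \sum_z \sum_z' g z * (g z')^* *
  (q%:R ^+ (M - d) * (H' (zsub (gpt z) (gpt z')).2 * `|K (zsub (gpt z) (gpt z'))| ^+ 2)) =
  q%:R ^+ (M - d) * \sum_(n' <- zrange N)
   \sum_(i <- [seq (n, k) | n <- zrange N, k <- L'])
     `|\sum_z g z * w ^ pairing (i.1 - n', i.2 + i.1 ^+ d - n' ^+ d) (gpt z)| ^+ 2.
  transitivity (q%:R ^+ (M - d) * \sum_(n' <- zrange N)
   \sum_(i <- [seq (n, k) | n <- zrange N, k <- L']) \sum_z \sum_z'
     g z * (g z')^* * w ^ pairing (i.1 - n', i.2 + i.1 ^+ d - n' ^+ d)
       (zsub (gpt z) (gpt z'))); last first.
    congr (_ * _); apply: eq_bigr => n' _; apply: eq_bigr => i _.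
    exact: energy_freq.
  rewrite mulr_sumr.
  under [RHS]eq_bigr do rewrite exchange_big mulr_sumr /=.
  rewrite [RHS]exchange_big; apply: eq_bigr => z _ /=.
  under [RHS]eq_bigr do rewrite exchange_big mulr_sumr /=.
  rewrite [RHS]exchange_big; apply: eq_bigr => z' _ /=.
  rewrite -[H' (_ - _)]/(H' (zsub (gpt z) (gpt z')).2) expand mulrCA !mulr_sumr.
  apply: eq_bigr => n' _; congr (_ * _).
  by rewrite mulr_sumr.
rewrite natrM natrX -!mulrA ler_wpM2l ?exprn_ge0 //.
(* Bessel is used for each n' separately; the sum over n' gives the factor 2N + 1. *)
apply: (@le_trans _ _ (\sum_(n' <- zrange N)
    (D ^ d.-1)%:R * (m%:R ^+ 2 * \sum_z `|g z| ^+ 2))); last first.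
  rewrite big_const_seq count_predT size_zrange iter_addr_0.
  by rewrite natrM -!mulrA [X in _ <= X]mulr_natl.
rewrite big_seq [X in _ <= X]big_seq; apply: ler_sum => n'.
rewrite mem_zrange => n'N.
have expb n : (absz n <= N)%N -> (absz (n ^+ d) <= N ^ d)%N.
  by rewrite abszX => nN; rewrite leq_exp2r.
apply: (@Bessel _ _ _ mw _ _
  (fun i : int * int => (i.1 - n', i.2 + i.1 ^+ d - n' ^+ d)) _ _ g Bm).
  case=> n k /allpairsP[[n1 k1] [/= n1N k1L [-> ->]]].
  move: n1N; rewrite mem_zrange => n1N.
  move: k1L; rewrite mem_filter => /andP[_ /curve_freqs_bounded kb].
  apply/andP => /=; split.
    apply: (@leq_trans (4 * N)); first lia.
    by rewrite -{1}(expn1 (4 * N)) leq_pexp2l //; lia.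
  have h : (2 ^ d.-1 * N ^ d + N ^ d + N ^ d <= (4 * N) ^ d)%N.
    rewrite -addnA addnn -mul2n -mulnDl expnMn leq_mul2r; apply/orP; right.
    have -> : (4 ^ d = 2 ^ d * (2 ^ d.-1).*2)%N.
      by rewrite (_ : 4 = 2 * 2)%N // expnMn -[in RHS]mul2n -expnS prednK.
    rewrite -[X in (X ^ d)%N]/(1.+1) -{2}(prednK d0) expnS.
    have := ltn_expl d.-1 (isT : (1 < 2)%N); nia.
  have := expb _ n1N; have := expb _ n'N; move: (n1 ^+ d) (n' ^+ d) => x y; lia.
(* The first coordinate determines n, then the second determines the value of k, which is nonzero in
   [L'] and occurs there at most D^(d-1) times. *)
move=> [y1 y2] _; rewrite count_flatten -map_comp sumnE big_map.
apply: (@leq_trans (\sum_(n <- zrange N | (n == y1 + n')%R) D ^ d.-1)%N).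
  rewrite [X in (_ <= X)%N]big_mkcond; apply: leq_sum => n _ /=.
  rewrite count_map; case: eqP => [->|nn]; last first.
    rewrite leqn0; apply/eqP/eqP; rewrite -leqn0 leqNgt -has_count; apply/hasPn => k _ /=.
    by rewrite xpair_eqE; apply/nandP; left; apply/eqP; lia.
  rewrite (@eq_count _ _ (pred1 (y2 + n' ^+ d - (y1 + n') ^+ d))); last first.
    move=> k /=; rewrite xpair_eqE addrK eqxx /=.
    by apply/eqP/eqP => [<-|->]; ring.
  have [->|k0] := eqVneq (y2 + n' ^+ d - (y1 + n') ^+ d) 0.
    rewrite leqNgt (@count_memPn _ _ _ _) //.
    by rewrite mem_filter eqxx.
  apply: leq_trans (count_curve_freqs d0 hD k0).
  by rewrite count_filter; apply: sub_count => k /andP[].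
rewrite big_const_seq iter_addn_0 -[X in (_ <= X)%N]muln1 leq_mul2l; apply/orP; right.
by rewrite (count_uniq_mem _ (uniq_zrange N)) leq_b1.
Qed.

End WeylSum.

(* A linear minorant of y^(M+2) - tau y^2, used in place of Jensen's inequality. *)
Lemma level_convexity (F : numFieldType) (M : nat) (tau L y : F) :
  0 <= y -> 0 < L -> 0 <= tau -> tau *+ 2 <= L ^+ M ->
  L ^+ M.+1 * (y - L *+ 2) <= (y ^+ M.+2 - tau * y ^+ 2) *+ 2.
Proof.
move=> y0 /ltW L0 t0 tL.
(* For y >= L, 2 (y^M - tau) is at least L^M. For y < L, the left side is at most -L^(M+2) and the
   right side at least that. *)
have [Ly|yL] := real_leP (ger0_real L0) (ger0_real y0).
  apply: (@le_trans _ _ (L ^+ M.+1 * y)).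
    by rewrite ler_wpM2l ?exprn_ge0 // lerBlDr lerDl mulrn_wge0.
  have h : L ^+ M <= y ^+ M by rewrite lerXn2r ?nnegrE.
  rewrite -[M.+2]addn2 exprD -mulrBl -mulrnAl.
  apply: (@le_trans _ _ (L ^+ M * y ^+ 2)).
    by rewrite [L ^+ M.+1]exprSr -mulrA ler_wpM2l ?exprn_ge0 // expr2 ler_wpM2r.
  rewrite ler_wpM2r ?exprn_ge0 // mulrnBl lerBrDr.
  by apply: (le_trans (lerD h tL)); rewrite [X in _ <= X]mulr2n lerD2l.
apply: (@le_trans _ _ (- (L ^+ M.+2))).
  rewrite [L ^+ M.+2]exprSr -mulrN ler_wpM2l ?exprn_ge0 // lerBlDr mulr2n addKr.
  exact: ltW.
rewrite mulrnBl lerBrDr addrC; apply: (@le_trans _ _ 0); last first.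
  by rewrite mulrn_wge0 // exprn_ge0.
rewrite subr_le0 -mulrnAl -[M.+2]addn2 exprD.
by apply: ler_pM; rewrite ?mulrn_wge0 ?exprn_ge0 // lerXn2r ?nnegrE // ltW.
Qed.

(** * Level sets by duality *)

Section LevelSet.
Variables (C : numClosedFieldType) (m : nat) (w : C).
Hypothesis mw : m.-primitive_root w.
Local Notation pt := ('I_m * 'I_m)%type.
Variable a : int -> C.

Definition mass N : C := \sum_(n <- zrange N) `|a n| ^+ 2.

Definition grid_sum d N (z : pt) : C :=
  \sum_(n <- zrange N) a n * w ^ pairing (curve d n) (gpt z).

Lemma mass_ge0 N : 0 <= mass N.
Proof. by apply: sumr_ge0 => n _; rewrite exprn_ge0. Qed.

(** The sum of |F| over G is a pairing of F with weights of modulus at most 1. Cauchy-Schwarz in n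
    splits off the mass, and the remaining squares expand into the kernel K(z - z'). *)
Lemma sqr_sum_grid_le d N (G : pred pt) :
  (\sum_(z in G) `|grid_sum d N z|) ^+ 2 <= mass N *
   \sum_(z in G) \sum_(z' in G) `|Weyl_sum w d N (zsub (gpt z) (gpt z'))|.
Proof.
(* The conjugate phase of F on G; where F vanishes, division by zero gives 0. *)
pose u (z : pt) : C := (z \in G)%:R * ((grid_sum d N z)^* / `|grid_sum d N z|).
have u1 z : `|u z| <= (z \in G)%:R.
  rewrite /u !normrM normfV normr_id norm_conjC normr_nat.
  have [->|F0] := eqVneq `|grid_sum d N z| 0; first by rewrite mul0r mulr0.
  by rewrite mulfV ?mulr1.
have XE : \sum_(z in G) `|grid_sum d N z| =
    \sum_(n <- zrange N) a n * \sum_z u z * w ^ pairing (curve d n) (gpt z).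
  rewrite big_mkcond.
  transitivity (\sum_z u z * grid_sum d N z).
    apply: eq_bigr => z _; rewrite /u; case: (z \in G); last by rewrite !mul0r.
    rewrite mul1r -mulrA [_^-1 * _]mulrC mulrA [_^* * _]mulrC -normCK.
    have [->|F0] := eqVneq `|grid_sum d N z| 0; first by rewrite invr0 mulr0.
    by rewrite expr2 mulfK.
  under eq_bigr do rewrite mulr_sumr.
  rewrite exchange_big; apply: eq_bigr => n _; rewrite mulr_sumr.
  by apply: eq_bigr => z _; rewrite mulrCA.
have X0 : 0 <= \sum_(z in G) `|grid_sum d N z| by exact: sumr_ge0.
rewrite -(ger0_norm X0) XE; apply: le_trans (CauchySchwarz_sum _ _ _) _.
rewrite ler_wpM2l ?mass_ge0 //.
under eq_bigr do rewrite -(energy_freq mw).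
rewrite exchange_big; under eq_bigr do rewrite exchange_big.
have u0 z : z \notin G -> u z = 0 by rewrite /u => /negbTE ->; rewrite mul0r.
clearbody u.
have pull z z' : \sum_(n <- zrange N) u z * (u z')^* * w ^ pairing (curve d n)
    (zsub (gpt z) (gpt z')) = u z * (u z')^* * Weyl_sum w d N (zsub (gpt z) (gpt z')).
  by rewrite mulr_sumr.
under eq_bigr do under eq_bigr do rewrite pull.
rewrite -[X in X <= _]ger0_norm; last first.
  under eq_bigr do under eq_bigr do rewrite -pull.
  under eq_bigr do rewrite exchange_big; rewrite exchange_big.
  by apply: sumr_ge0 => n _; rewrite (energy_freq mw) exprn_ge0.
apply: le_trans (ler_norm_sum _ _ _) _; rewrite [X in _ <= X]big_mkcond.
apply: ler_sum => z _; case: ifPn => [zG|/u0 uz]; last first.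
  by rewrite big1 ?normr0 // => z' _; rewrite uz !mul0r.
apply: le_trans (ler_norm_sum _ _ _) _; rewrite [X in _ <= X]big_mkcond.
apply: ler_sum => z' _; case: ifPn => [zG'|/u0 uz]; last first.
  by rewrite uz rmorph0 mulr0 mul0r normr0.
rewrite !normrM norm_conjC ler_piMl // mulr_ile1 //.
  by apply: le_trans (u1 z) _; rewrite lern1 leq_b1.
by apply: le_trans (u1 z') _; rewrite lern1 leq_b1.
Qed.

(** Duality makes the mean of |K(z - z')| over pairs of points of G at least 4L. The linear minorant
    gives up 2L of it; the remaining 2 L^(M+2) |G|^2 is at most twice the energy, whose bound is
    only linear in |G|. *)
Lemma level_set d N D (G : pred pt) (L : C) : (2 < d)%N -> (0 < N)%N ->
  divisor_bound ((4 * N) ^ d) D -> (((4 * N) ^ d).*2 < m)%N ->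
  0 < mass N -> 0 < L ->
  (N.*2.*2.+1 ^ (2 ^ d.-1 - d) * (d * N.*2.*2.+1 ^ d.-1))%:R *+ 2 <= L ^+ (2 ^ d.-1) ->
  {in G, forall z, mass N * (L *+ 4) <= `|grid_sum d N z| ^+ 2} ->
  L ^+ (2 ^ d.-1).+2 * #|G|%:R <=
    (N.*2.*2.+1 ^ (2 ^ d.-1 - d) * (N.*2.+1 * D ^ d.-1))%:R * m%:R ^+ 2.
Proof.
move=> d2 N0 hD Bm A0 L0 hL hG.
have [G0|G0] := posnP #|G|.
  by rewrite G0 mulr0 mulr_ge0 // exprn_ge0.
have g0 : 0 < #|G|%:R :> C by rewrite ltr0n.
rewrite -(ler_pM2r g0); apply: le_trans (energy_bound mw G d2 N0 hD Bm).
set tau : C := (_ * (d * _))%:R in hL *.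
set S1 := \sum_(z in G) \sum_(z' in G) `|Weyl_sum w d N (zsub (gpt z) (gpt z'))|.
have S1L : L *+ 4 * #|G|%:R ^+ 2 <= S1.
  rewrite -(ler_pM2l A0); apply: le_trans (sqr_sum_grid_le _ _ _).
  have AL : 0 <= mass N * (L *+ 4) by rewrite mulr_ge0 ?mulrn_wge0 // ltW.
  rewrite mulrA -[mass N * _]sqrtCK -exprMn.
  rewrite lerXn2r ?nnegrE ?mulr_ge0 ?sqrtC_ge0 ?sumr_ge0 //.
  rewrite mulr_natr -sumr_const; apply: ler_sum => z zG.
  by rewrite -(@ler_pXn2r _ 2) ?nnegrE ?sqrtC_ge0 // sqrtCK hG.
set E := \sum_(z in G) _.
have h : L ^+ (2 ^ d.-1).+1 * (S1 - L *+ 2 * #|G|%:R ^+ 2) <= E *+ 2.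
  rewrite /E -sumrMnl.
  have -> : L *+ 2 * #|G|%:R ^+ 2 = \sum_(z in G) \sum_(z' in G) L *+ 2.
    by rewrite !sumr_const expr2 mulrA !mulr_natr.
  rewrite -sumrB mulr_sumr; apply: ler_sum => z _.
  rewrite -sumrB mulr_sumr -sumrMnl; apply: ler_sum => z' _.
  by apply: level_convexity.
rewrite -(ler_pM2l (ltr0n C 2)) [X in _ <= X]mulr_natl; apply: le_trans h.
rewrite [L ^+ _.+2]exprSr -mulrA -mulrA mulrCA ler_wpM2l ?exprn_ge0 ?(ltW L0) //.
rewrite lerBrDr; apply: le_trans S1L; rewrite le_eqVlt; apply/orP; left; apply/eqP.
rewrite -mulr_natr -[L *+ 4]mulr_natr; ring.
Qed.
End LevelSet.

(** * Fourth and sixth moments *)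

Lemma expr_sum_le (F : numDomainType) (T : eqType) (s : seq T) (f : T -> F) k :
  (0 < k)%N -> (forall i, 0 <= f i) ->
  (\sum_(i <- s) f i) ^+ k <= (size s)%:R ^+ k * \sum_(i <- s) f i ^+ k.
Proof.
move=> k0 f0.
(* [x] is the maximum of the values, or 0 for the empty list. *)
have [x [x0 fx xk]] : exists x, [/\ 0 <= x, {in s, forall i, f i <= x}
    & x ^+ k <= \sum_(i <- s) f i ^+ k].
  elim: s => [|i s [x [x0 fx xk]] ].
    by exists 0; rewrite big_nil expr0n gtn_eqF.
  have [ix|xi] := real_leP (ger0_real (f0 i)) (ger0_real x0).
    exists x; split=> //; last by rewrite big_cons ler_wpDl ?exprn_ge0.
    by move=> l; rewrite inE => /predU1P[->|/fx].
  exists (f i); split=> //.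
    move=> l; rewrite inE => /predU1P[->//|/fx] /le_trans; apply.
    exact: ltW.
  by rewrite big_cons lerDl sumr_ge0 // => l _; rewrite exprn_ge0.
apply: (@le_trans _ _ (((size s)%:R * x) ^+ k)).
  rewrite lerXn2r ?nnegrE ?sumr_ge0 ?mulr_ge0 // big_seq.
  apply: (@le_trans _ _ (\sum_(i <- s | i \in s) x)); first exact: ler_sum.
  by rewrite -big_seq big_const_seq count_predT iter_addr_0 mulr_natl.
by rewrite exprMn ler_wpM2l // exprn_ge0.
Qed.

Lemma odd_dvdz_add (d : nat) (x y : int) : odd d -> (x + y %| x ^+ d + y ^+ d)%Z.
Proof.
move=> od; have -> : x ^+ d + y ^+ d = x ^+ d - (- y) ^+ d.
  by rewrite exprNn -signr_odd od expr1 mulN1r opprK.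
by rewrite subrXX opprK dvdz_mulr.
Qed.

Lemma expnD_gt (d x y : nat) : (1 < d)%N -> (0 < x)%N -> (0 < y)%N ->
  (x ^ d + y ^ d < (x + y) ^ d)%N.
Proof.
case: d => // d d0 x0 y0.
have h : forall e, (0 < e)%N -> (x ^ e + y ^ e <= (x + y) ^ e)%N.
  by elim=> // -[//|e] IH _; rewrite 3!(expnS _ e.+1); have := IH isT; nia.
have := h d d0; rewrite 3!(expnS _ d).
have : (0 < x ^ d)%N by rewrite expn_gt0 x0.
nia.
Qed.

(** Once the common sign is factored out, this is the strict superadditivity of d-th powers of
    positive integers. *)
Lemma sum3_expz_neq (d : nat) (x y z s : int) : (1 < d)%N -> s != 0 ->
  sgz x = s -> sgz y = s -> sgz z = s ->
  (x + y + z) ^+ d - (x ^+ d + y ^+ d + z ^+ d) != 0.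
Proof.
move=> d1 s0 xs ys zs.
have pos t : sgz t = s -> (0 < absz t)%N.
  by move=> ts; rewrite absz_gt0 -sgz_eq0 ts.
have E t : sgz t = s -> t = s * (absz t)%:Z by move=> <-; rewrite abszE -numEsg.
have x0 := pos _ xs; have y0 := pos _ ys; have z0 := pos _ zs.
rewrite (E _ xs) (E _ ys) (E _ zs) -!mulrDr !exprMn -!mulrDr -mulrBr.
rewrite mulf_neq0 ?expf_neq0 // subr_eq0 -!PoszD -!rmorphXn -!PoszD /= eqz_nat.
rewrite gtn_eqF //; apply: leq_ltn_trans (expnD_gt d1 (ltn_addr _ x0) z0).
by rewrite leq_add2r ltnW // expnD_gt.
Qed.

Section LowMoments.
Variables (C : numClosedFieldType) (m : nat) (w : C).
Hypothesis mw : m.-primitive_root w.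
Let w1 : `|w| = 1 := norm_prim_root mw.
Let wn0 : w != 0 := w_neq0 w1.
Variable a : int -> C.

Lemma fourth_moment d N : ~~ odd d -> (0 < d)%N -> (((4 * N) ^ d).*2 < m)%N ->
  \sum_(z : 'I_m * 'I_m) `|grid_sum w a d N z| ^+ 4 <= d%:R * (m%:R ^+ 2 * mass a N ^+ 2).
Proof.
move=> ed d0 Bm.
pose s2 := [seq (n1, n2) | n1 <- zrange N, n2 <- zrange N].
pose f (i : int * int) := (i.1 + i.2, i.1 ^+ d + i.2 ^+ d).
pose b (i : int * int) := a i.1 * a i.2.
have -> : \sum_(z : 'I_m * 'I_m) `|grid_sum w a d N z| ^+ 4 =
    \sum_(z : 'I_m * 'I_m) `|\sum_(i <- s2) b i * w ^ pairing (f i) (gpt z)| ^+ 2.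
  apply: eq_bigr => z _; rewrite (exprM _ 2 2) -normrX; congr (`|_| ^+ 2).
  rewrite big_allpairs expr2 mulr_suml; apply: eq_bigr => n1 _.
  rewrite mulr_sumr; apply: eq_bigr => n2 _.
  rewrite mulrACA -expfzDr //; congr (_ * w ^ _); rewrite /pairing /=; ring.
have -> : mass a N ^+ 2 = \sum_(i <- s2) `|b i| ^+ 2.
  rewrite big_allpairs expr2 mulr_suml; apply: eq_bigr => n1 _.
  by rewrite mulr_sumr; apply: eq_bigr => n2 _; rewrite normrM exprMn.
have expb n : (absz n <= N)%N -> (absz (n ^+ d) <= N ^ d)%N.
  by rewrite abszX => nN; rewrite leq_exp2r.
apply: (@dual_Bessel _ _ _ mw _ s2 f _ _ b Bm) => [ [n1 n2] /allpairsP[[x y] [/= xN yN [-> ->]]]|].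
  move: xN yN; rewrite !mem_zrange => xN yN.
  have := expb _ xN; have := expb _ yN; rewrite /in_box /f /=.
  have : (N <= N ^ d)%N by case: (posnP N) => [->//|N0]; rewrite -{1}(expn1 N) leq_pexp2l.
  have : (4 * N ^ d <= (4 * N) ^ d)%N.
    by rewrite expnMn leq_mul2r -{1}(expn1 4) leq_pexp2l ?orbT.
  by move: (x ^+ d) (y ^+ d) ((4 * N) ^ d)%N (N ^ d)%N => X Y B E; lia.
case=> h k _; rewrite count_flatten -map_comp sumnE big_map.
(* As d is even, n1 + n2 = h and n1^d + n2^d = k make n1 a root of [P]. The two terms of degree d
   add up to the coefficient 2 instead of cancelling, so [P] has at most d roots; n2 = h - n1
   follows. *)
pose P : {poly int} := ('X - h%:P) ^+ d + 'X^d - k%:P.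
have P0 : P`_d = 2.
  have := monicP (monic_exp d (monicXsubC h)); rewrite lead_coefE size_exp_XsubC /= => e.
  by rewrite coefB coefD coefC coefXn e eqxx (gtn_eqF d0) subr0.
have sP : (size P <= d.+1)%N.
  apply/leq_sizeP => i di; rewrite coefB coefD coefC coefXn (gtn_eqF di).
  rewrite (gtn_eqF (leq_ltn_trans _ di)) // nth_default ?size_exp_XsubC //.
have nP : P != 0 by apply: contra_eq_neq P0 => ->; rewrite coef0.
apply: (@leq_trans (count (root P) (zrange N))); last first.
  rewrite -size_filter -ltnS; apply: leq_trans sP.
  apply: max_poly_roots => //; last by rewrite filter_uniq // uniq_zrange.
  by rewrite filter_all.
rewrite -sum1_count [X in (_ <= X)%N]big_mkcond; apply: leq_sum => n _ /=.
rewrite count_map.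
have [r|r] := boolP (root P n).
  apply: (@leq_trans (count_mem (h - n) (zrange N))).
    by apply: sub_count => x /eqP[<- _]; rewrite /= addrAC subrr add0r.
  by rewrite (count_uniq_mem _ (uniq_zrange N)) leq_b1.
rewrite leqn0 -leqn0 leqNgt -has_count; apply: contra r => /hasP[x _ /eqP[hE kE]].
rewrite rootE /P !hornerE /= -hE -kE opprD addNKr exprNn -signr_odd (negbTE ed).
by rewrite mul1r [x ^+ d + _]addrC subrr.
Qed.

(* Frequencies of one sign exclude the solutions with n_i + n_j = 0, so that
   h^d - k is nonzero; it is divisible by each h - n_i. *)
Lemma sixth_moment_sign d N D (s : int) : odd d -> (1 < d)%N -> (0 < N)%N ->
  divisor_bound ((4 * N) ^ d) D -> (((4 * N) ^ d).*2 < m)%N ->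
  \sum_(z : 'I_m * 'I_m) `|\sum_(n <- zrange N | sgz n == s)
      a n * w ^ pairing (curve d n) (gpt z)| ^+ 6 <=
    (D ^ 2)%:R * (m%:R ^+ 2 * mass a N ^+ 3).
Proof.
move=> od d1 N0 hD Bm; have d0 := ltnW d1.
pose r := [seq n <- zrange N | sgz n == s].
have ur : uniq r by rewrite filter_uniq // uniq_zrange.
have rN n : n \in r -> sgz n = s /\ (absz n <= N)%N.
  by rewrite mem_filter mem_zrange => /andP[/eqP].
pose r3 := [seq (n1, i) | n1 <- r, i <- [seq (n2, n3) | n2 <- r, n3 <- r] ].
pose f (i : int * (int * int)) :=
  (i.1 + i.2.1 + i.2.2, i.1 ^+ d + i.2.1 ^+ d + i.2.2 ^+ d).
pose b (i : int * (int * int)) := a i.1 * (a i.2.1 * a i.2.2).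
have -> : \sum_(z : 'I_m * 'I_m) `|\sum_(n <- zrange N | sgz n == s)
      a n * w ^ pairing (curve d n) (gpt z)| ^+ 6 =
    \sum_(z : 'I_m * 'I_m) `|\sum_(i <- r3) b i * w ^ pairing (f i) (gpt z)| ^+ 2.
  apply: eq_bigr => z _; rewrite (exprM _ 3 2) -normrX; congr (`|_| ^+ 2).
  rewrite -big_filter -/r big_allpairs exprS expr2 mulr_suml; apply: eq_bigr => n1 _.
  rewrite big_allpairs mulr_suml mulr_sumr; apply: eq_bigr => n2 _.
  rewrite !mulr_sumr; apply: eq_bigr => n3 _.
  rewrite [(a n2 * _) * _]mulrACA -expfzDr // mulrACA -expfzDr //.
  congr (_ * w ^ _); rewrite /pairing /=; ring.
apply: (@le_trans _ _ ((D ^ 2)%:R * (m%:R ^+ 2 * \sum_(i <- r3) `|b i| ^+ 2))); last first.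
  rewrite !ler_wpM2l ?exprn_ge0 //.
  apply: (@le_trans _ _ ((\sum_(n <- r) `|a n| ^+ 2) ^+ 3)).
    rewrite big_allpairs exprS expr2 mulr_suml le_eqVlt; apply/orP; left; apply/eqP.
    apply: eq_bigr => n1 _; rewrite big_allpairs mulr_suml mulr_sumr.
    apply: eq_bigr => n2 _; rewrite !mulr_sumr; apply: eq_bigr => n3 _.
    by rewrite !normrM !exprMn.
  rewrite lerXn2r ?nnegrE ?mass_ge0 //.
    by rewrite sumr_ge0 // => n _; rewrite exprn_ge0.
  rewrite big_filter [X in X <= _]big_mkcond; apply: ler_sum => n _.
  by case: ifP => // _; rewrite exprn_ge0.
have expb n : (absz n <= N)%N -> (absz (n ^+ d) <= N ^ d)%N.
  by rewrite abszX => nN; rewrite leq_exp2r.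
have Nd : (N <= N ^ d)%N by rewrite -{1}(expn1 N) leq_pexp2l.
(* Room in the box for [kappa] below, which involves (n1 + n2 + n3)^d, at most (3N)^d in absolute
   value, and three d-th powers. *)
have h43 : (3 ^ d + 3 <= 4 ^ d)%N.
  case: (d) d1 => [|[|e]] // _; elim: e => // e IH.
  by rewrite [(3 ^ _)%N]expnS [(4 ^ _)%N]expnS; lia.
have Bd : ((3 * N) ^ d + 3 * N ^ d <= (4 * N) ^ d)%N.
  by rewrite !expnMn -mulnDl leq_mul2r h43 orbT.
apply: (@dual_Bessel _ _ _ mw _ r3 f _ _ b Bm).
  move=> i /allpairsP[[n1 i'] [/= /rN[_ n1N]]].
  move=> /allpairsP[[n2 n3] [/= /rN[_ n2N] /rN[_ n3N] ->]] ->.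
  have := expb _ n1N; have := expb _ n2N; have := expb _ n3N; rewrite /in_box /f /=.
  have : (N <= (3 * N) ^ d)%N.
    by apply: (leq_trans Nd); rewrite leq_exp2r // leq_pmull.
  move: Bd; move: (n1 ^+ d) (n2 ^+ d) (n3 ^+ d) ((4 * N) ^ d)%N ((3 * N) ^ d)%N (N ^ d)%N Nd.
  by move=> X Y Z B B' E; lia.
case=> h k _.
(* For the sign 0 the only frequency is n = 0. *)
have [s0|s0] := eqVneq s 0.
  apply: leq_trans (count_size _ _) _; rewrite !size_allpairs.
  have r1 : (size r <= 1)%N.
    apply: (@uniq_leq_size _ r [:: 0] ur) => n /rN[+ _].
    by rewrite s0 => /eqP; rewrite sgz_eq0 inE.
  have D2 : (2 <= D)%N.
    by apply: (hD 1) => //; rewrite expn_gt0 muln_gt0 N0.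
  apply: (@leq_trans 1); last by rewrite expn_gt0 (ltnW D2).
  by rewrite -[X in (_ <= X)%N](muln1 1) leq_mul // -[X in (_ <= X)%N](muln1 1) leq_mul.
(* [S] lists the candidates for each n_i; there are at most [D], since h - n_i divides the nonzero
   [kappa]. A solution is determined by n_1 and n_2, hence the bound D^2. *)
pose kappa := h ^+ d - k.
pose S := [seq n <- r | (h - n %| kappa)%Z].
rewrite -size_filter; set T := seq.filter _ _.
have T3 i : i \in T -> [/\ f i = (h, k), i.1 \in r, i.2.1 \in r & i.2.2 \in r].
  rewrite mem_filter => /andP[/eqP fi /allpairsP[[n1 i'] [/= n1r]]].
  by case/allpairsP=> [[n2 n3] [/= n2r n3r ->]] ie; rewrite ie in fi *.
have [T0|T0] := posnP (size T); first by rewrite T0.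
have [i0 i0T] : exists i0, i0 \in T by case: (T) T0 => // i0 *; exists i0; rewrite mem_head.
have [k0 kB] : kappa != 0 /\ (absz kappa <= (4 * N) ^ d)%N.
  have [[hE kE] /rN[s1 b1] /rN[s2 b2] /rN[s3 b3]] := T3 _ i0T.
  rewrite /kappa -hE -kE; split; first exact: (sum3_expz_neq d1 s0).
  have : (absz ((i0.1 + i0.2.1 + i0.2.2) ^+ d) <= (3 * N) ^ d)%N.
    by rewrite abszX leq_exp2r //; clear -b1 b2 b3; lia.
  have := expb _ b1; have := expb _ b2; have := expb _ b3; move: Bd.
  move: (i0.1 ^+ d) (i0.2.1 ^+ d) (i0.2.2 ^+ d) ((_ + _ + _) ^+ d)
    ((4 * N) ^ d)%N ((3 * N) ^ d)%N (N ^ d)%N.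
  by clear=> X Y Z U B B' E; lia.
have SD : (size S <= D)%N.
  apply: leq_trans (hD _ k0 kB); rewrite -(size_map (fun n => h - n)).
  apply: size_zdivisors => //.
    by rewrite map_inj_uniq ?filter_uniq ?uniq_zrange // => x y /addrI/oppr_inj.
  by move=> x /mapP[n]; rewrite mem_filter => /andP[nk _] ->.
(* h - n_1 = n_2 + n_3 divides h^d - n_1^d and, d being odd, also n_2^d + n_3^d; the difference of
   the two is [kappa]. The same holds for n_2. *)
have TS i : i \in T -> (i.1, i.2.1) \in [seq (x, y) | x <- S, y <- S].
  move=> /T3[[hE kE] r1 r2 r3']; rewrite allpairs_f // mem_filter ?r1 ?r2 andbT /kappa.
    rewrite -kE (_ : _ - _ = (h ^+ d - i.1 ^+ d) - (i.2.1 ^+ d + i.2.2 ^+ d)); last by ring.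
    apply: rpredB; first by rewrite subrXX dvdz_mulr.
    rewrite (_ : h - i.1 = i.2.1 + i.2.2) ?odd_dvdz_add //; rewrite -hE; ring.
  rewrite -kE (_ : _ - _ = (h ^+ d - i.2.1 ^+ d) - (i.1 ^+ d + i.2.2 ^+ d)); last by ring.
  apply: rpredB; first by rewrite subrXX dvdz_mulr.
  rewrite (_ : h - i.2.1 = i.1 + i.2.2) ?odd_dvdz_add //; rewrite -hE; ring.
apply: (@leq_trans (size [seq (x, y) | x <- S, y <- S])); last first.
  by rewrite size_allpairs expnS expn1 leq_mul.
rewrite -(size_map (fun i : int * (int * int) => (i.1, i.2.1))).
apply: uniq_leq_size => [|x /mapP[i /TS iS ->] //].
rewrite map_inj_in_uniq ?filter_uniq //.
  by rewrite !allpairs_uniq // => -[x y] [x' y'] _ _ [-> ->].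
move=> [x1 [x2 x3]] [y1 [y2 y3]] /T3[[/= hx _] _ _ _] /T3[[/= hy _] _ _ _] [e1 e2].
by rewrite -e1 -e2 in hy *; do 2 congr (_, _); move: hx; rewrite -hy => /addrI.
Qed.

End LowMoments.

(** * From level sets to the moment of order p0 *)

Lemma sum_expn2_le (k n : nat) : (0 < k)%N ->
  (\sum_(i < n.+1) 2 ^ (i * k) <= 2 * 2 ^ (n * k))%N.
Proof.
move=> k0; elim: n => [|n IH]; first by rewrite big_ord_recr big_ord0.
rewrite big_ord_recr /= (mulSn n) expnD.
rewrite [X in (_ <= X)%N]mul2n -addnn leq_add2r; apply: leq_trans IH _.
by rewrite leq_mul2r -[X in (X <= 2 ^ k)%N](expn1 2) leq_exp2l // k0 orbT.
Qed.

(** The single term with 4 2^i <= v < 8 2^i already dominates v^s. *)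
Lemma layer_cake_pointwise (F : numDomainType) (v : F) (s i0 n : nat) :
  0 <= v -> (i0 <= n)%N -> (4 * 2 ^ i0)%:R <= v -> v < (4 * 2 ^ n)%:R ->
  v ^+ s <= \sum_(i < n | (i0 <= i)%N && ((4 * 2 ^ i)%:R <= v)) (8 * 2 ^ i)%:R ^+ s.
Proof.
move=> v0; elim: n => [|n IH] i0n iv vn.
  by move: i0n iv; rewrite leqn0 => /eqP -> /le_lt_trans /(_ vn); rewrite ltxx.
rewrite big_mkcond big_ord_recr -big_mkcond /=.
have [nv|nv] := real_leP (realn _ (4 * 2 ^ n)) (ger0_real v0); last first.
  rewrite andbF addr0; apply: IH => //; rewrite leqNgt; apply/negP => ni0.
  have := le_lt_trans iv nv; rewrite ltr_nat ltn_mul2l ltn_exp2l //; lia.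
have ni : (i0 <= n)%N.
  rewrite -ltnS ltn_neqAle i0n andbT; apply/eqP => e.
  by move: (le_lt_trans iv vn); rewrite e ltxx.
rewrite ni /= ler_wpDl //; first by apply: sumr_ge0 => i _; rewrite exprn_ge0.
rewrite lerXn2r ?nnegrE // (le_trans (ltW vn)) // ler_nat expnS; lia.
Qed.

(** The sum is split at the level 4 2^i0. Below it, v^(M e) is at most (8^M X)^e and the moment of
    order b remains. Above it, the dyadic level i contributes 2^(i k) W2 up to a constant: a
    geometric series of size V^k, because k > 0. *)
Lemma weak_to_strong (F : numDomainType) (Z : finType) (v : Z -> F)
    (M b e k X V : nat) (W1 W2 : F) :
  (0 < X)%N -> (0 < M)%N -> (0 < k)%N -> (M * e + b = M.+2 + k)%N ->
  (forall z, 0 <= v z) -> (forall z, v z <= V%:R) ->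
  \sum_z v z ^+ b <= W1 -> 0 <= W2 ->
  (forall i, (X <= 2 ^ (i * M))%N ->
     (2 ^ i)%:R ^+ M.+2 * #|[pred z | (4 * 2 ^ i)%:R <= v z]|%:R <= W2) ->
  \sum_z v z ^+ (M * e + b) <=
    ((8 ^ M * X) ^ e)%:R * W1 + (8 ^ (M * e + b) * (2 * V ^ k))%:R * W2.
Proof.
move=> X0 M0 k0 sE v0 vV hW1 W20 hW2; set s := (M * e + b)%N.
have exi : exists i, (X <= 2 ^ (i * M))%N.
  exists X; apply: ltnW; apply: leq_trans (ltn_expl X (isT : 1 < 2)%N) _.
  by rewrite leq_exp2l // leq_pmulr.
(* The first level at which the weak bound is available. Minimality gives 2^(i0 M) <= 2^M X, hence
   (4 2^i0)^M <= 8^M X. *)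
pose i0 := ex_minn exi.
have [Xi0 i0X] : (X <= 2 ^ (i0 * M))%N /\ (2 ^ (i0 * M) <= 2 ^ M * X)%N.
  rewrite /i0; case: ex_minnP => i Xi mini; split => //.
  case: i Xi mini => [|i] Xi mini.
    by rewrite mul0n muln_gt0 expn_gt0 X0.
  rewrite (mulSn i) expnD leq_mul2l ltnW ?orbT // ltnNge; apply/negP => /mini.
  by rewrite ltnn.
have [V0|V0] := posnP V.
  have vz z : v z = 0 by apply/le_anti; rewrite v0 -[0]/(0%:R) -V0 vV.
  rewrite (eq_bigr (fun=> 0)) => [|z _]; last by rewrite vz expr0n /s sE.
  rewrite big1 // addr_ge0 ?mulr_ge0 //; apply: le_trans hW1.
  by apply: sumr_ge0 => z _; rewrite exprn_ge0.
pose n := (maxn i0 (trunc_log 2 V).+1).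
have Vn : (V < 4 * 2 ^ n)%N.
  apply: (@leq_trans (2 ^ n)); last by rewrite leq_pmull.
  apply: leq_trans (trunc_log_ltn V (isT : 1 < 2)%N) _.
  by rewrite leq_exp2l // leq_maxr.
apply: (@le_trans _ _ (\sum_z (((8 ^ M * X) ^ e)%:R * v z ^+ b +
  \sum_(i < n | (i0 <= i)%N && ((4 * 2 ^ i)%:R <= v z)) (8 * 2 ^ i)%:R ^+ s))).
  apply: ler_sum => z _.
  have [h|h] := real_leP (realn _ (4 * 2 ^ i0)) (ger0_real (v0 z)).
    apply: ler_wpDl; first by rewrite mulr_ge0 ?exprn_ge0.
    apply: layer_cake_pointwise => //; first by rewrite leq_maxl.
    by apply: (le_lt_trans (vV z)); rewrite ltr_nat.
  apply: ler_wpDr; first by apply: sumr_ge0 => i _; rewrite exprn_ge0.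
  rewrite exprD ler_wpM2r ?exprn_ge0 // exprM natrX lerXn2r ?nnegrE ?exprn_ge0 //.
  apply: (@le_trans _ _ ((4 * 2 ^ i0)%:R ^+ M)).
    by rewrite lerXn2r ?nnegrE // ltW.
  rewrite -natrX ler_nat expnMn -expnM (_ : 8 = 4 * 2)%N // expnMn -mulnA.
  by rewrite leq_mul2l i0X orbT.
rewrite big_split /= -mulr_sumr lerD //; first by rewrite ler_wpM2l.
rewrite (exchange_big_dep xpredT) //=.
(* Levels i >= t are empty, since v <= V < 2^t. *)
pose t := (trunc_log 2 V).+1.
apply: (@le_trans _ _ (\sum_(i < t) (8 ^ s * 2 ^ (i * k))%:R * W2)); last first.
  rewrite -mulr_suml ler_wpM2r // -natr_sum ler_nat -big_distrr /= leq_mul2l.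
  apply/orP; right; apply: leq_trans (sum_expn2_le _ k0) _.
  by rewrite leq_mul2l /= expnM leq_exp2r // trunc_logP.
rewrite (big_ord_widen n (fun i => (8 ^ s * 2 ^ (i * k))%:R * W2)); last exact: leq_maxr.
rewrite [X in _ <= X]big_mkcond /=; apply: ler_sum => i _.
have [ii|ii] := leqP i0 i; last first.
  by rewrite big_pred0 //; case: ifP => // _; rewrite mulr_ge0.
rewrite sumr_const /=.
have [G0|G0] := posnP #|[pred z | (4 * 2 ^ i)%:R <= v z]|.
  rewrite (eq_card (_ : _ =i [pred z | (4 * 2 ^ i)%:R <= v z])) // G0 mulr0n.
  by case: ifP => // _; rewrite mulr_ge0.
have iV : (i < t)%N.
  move/card_gt0P: (G0) => [z]; rewrite inE => hz.
  have : (4 * 2 ^ i)%:R <= V%:R :> F by apply: le_trans hz (vV z).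
  rewrite ler_nat => iV; rewrite /t ltnS trunc_log_max //.
  by apply: leq_trans iV; rewrite leq_pmull.
rewrite iV -[X in X <= _]mulr_natr.
rewrite (_ : (8 * 2 ^ i)%:R ^+ s = (8 ^ s * 2 ^ (i * k))%:R * (2 ^ i)%:R ^+ M.+2 :> F); last first.
  rewrite -!natrX -natrM expnMn -mulnA; congr (_ * _)%:R.
  by rewrite -!expnM -expnD /s sE mulnDr addnC.
have hi : (X <= 2 ^ (i * M))%N.
  by apply: leq_trans Xi0 _; rewrite leq_exp2l // leq_mul2r ii orbT.
rewrite -mulrA ler_wpM2l //; exact: hW2 i hi.
Qed.

Section SixthMoment.
Variables (C : numClosedFieldType) (m : nat) (w : C).
Hypothesis mw : m.-primitive_root w.
Variable a : int -> C.

(** F is split by the sign of the frequency. The sixth power of a sum of three terms costs 3^6, and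
    adding the three moments makes it 3^7. *)
Lemma sixth_moment d N D : odd d -> (1 < d)%N -> (0 < N)%N ->
  divisor_bound ((4 * N) ^ d) D -> (((4 * N) ^ d).*2 < m)%N ->
  \sum_(z : 'I_m * 'I_m) `|grid_sum w a d N z| ^+ 6 <=
    (3 ^ 7 * D ^ 2)%:R * (m%:R ^+ 2 * mass a N ^+ 3).
Proof.
move=> od d1 N0 hD Bm.
pose F s (z : 'I_m * 'I_m) :=
  \sum_(n <- zrange N | sgz n == s) a n * w ^ pairing (curve d n) (gpt z).
pose signs : seq int := [:: -1; 0; 1].
have split z : grid_sum w a d N z = \sum_(s <- signs) F s z.
  rewrite /F; under eq_bigr do rewrite big_mkcond /=.
  rewrite exchange_big; apply: eq_bigr => n _ /=; rewrite 3!big_cons big_nil.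
  by case: (sgzP n) => _; rewrite /= ?addr0 ?add0r.
apply: (@le_trans _ _ (\sum_(z : 'I_m * 'I_m) (3 ^+ 6 * \sum_(s <- signs) `|F s z| ^+ 6))).
  apply: ler_sum => z _; rewrite split.
  apply: le_trans (expr_sum_le signs (f := fun s => `|F s z|) (isT : 0 < 6)%N _) => //.
  by rewrite lerXn2r ?nnegrE ?sumr_ge0 //; exact: ler_norm_sum.
rewrite -mulr_sumr exchange_big natrM natrX [3 ^+ 7]exprSr -2![X in _ <= X]mulrA.
rewrite ler_wpM2l ?exprn_ge0 //.
apply: (@le_trans _ _ (\sum_(s <- signs) (D ^ 2)%:R * (m%:R ^+ 2 * mass a N ^+ 3))).
  by apply: ler_sum => s _; exact: sixth_moment_sign.
by rewrite big_const_seq count_predT iter_addr_0 [X in _ <= X]mulr_natl.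
Qed.

End SixthMoment.

(* p0 = 2 (M e + b) with M = 2^(d-1), b = low_exp, e = low_mult and e + b = d + 1. *)
Definition low_exp (d : nat) : nat := if odd d then 3 else 2.
Definition low_mult (d : nat) : nat := (d.+1 - low_exp d)%N.
Definition half_p0 (d : nat) : nat := (2 ^ d.-1 * low_mult d + low_exp d)%N.

Lemma p0E d : (2 < d)%N -> p0 d = (2 * half_p0 d)%N.
Proof.
case: d => // d d2; rewrite /half_p0 /low_mult /low_exp /p0 expnS [_.+1.-1]/=.
by case: (odd d.+1); rewrite ?subSS; lia.
Qed.

(** This is p0 > 2M + 4, which makes the exponent k of the dyadic summation positive. It is tight
    for d = 3, where it reads 6 < 7. *)
Lemma half_p0_gt d : (2 < d)%N -> ((2 ^ d.-1).+2 < half_p0 d)%N.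
Proof.
move=> d2; rewrite /half_p0 /low_mult /low_exp.
have : (0 < 2 ^ d.-1)%N by rewrite expn_gt0.
have [od|ed] := boolP (odd d); move: (2 ^ d.-1)%N => M; first nia.
have : (3 < d)%N by case: (d) d2 ed => [|[|[|[|]]]].
nia.
Qed.

Section LowMoment.
Variables (C : numClosedFieldType) (m : nat) (w : C).
Hypothesis mw : m.-primitive_root w.
Variable a : int -> C.

Lemma low_moment d N D : (2 < d)%N -> (0 < N)%N ->
  divisor_bound ((4 * N) ^ d) D -> (((4 * N) ^ d).*2 < m)%N ->
  \sum_(z : 'I_m * 'I_m) `|grid_sum w a d N z| ^+ (2 * low_exp d) <=
    ((d + 3 ^ 7) * D ^ d.-1)%:R * (m%:R ^+ 2 * mass a N ^+ low_exp d).
Proof.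
move=> d2 N0 hD Bm; rewrite /low_exp.
have D2 : (2 <= D)%N by apply: (hD 1) => //; rewrite expn_gt0 muln_gt0 N0.
have mm i : 0 <= m%:R ^+ 2 * mass a N ^+ i.
  by rewrite mulr_ge0 ?exprn_ge0 // mass_ge0.
case: (boolP (odd d)) => od.
  apply: le_trans (sixth_moment mw a od (ltnW d2) N0 hD Bm) _.
  rewrite ler_wpM2r // ler_nat leq_mul ?leq_addl // leq_pexp2l //; lia.
apply: le_trans (fourth_moment mw a od _ Bm) _; first lia.
by rewrite ler_wpM2r // ler_nat -[X in (X <= _)%N]muln1 leq_mul ?leq_addr // expn_gt0; lia.
Qed.

Lemma grid_sum_le d N (z : 'I_m * 'I_m) : `|grid_sum w a d N z| ^+ 2 <= (N.*2.+1)%:R * mass a N.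
Proof.
apply: le_trans (CauchySchwarz_sum _ _ _) _; rewrite mulrC.
under eq_bigr do rewrite (norm_expz (norm_prim_root mw)) expr1n.
by rewrite big_const_seq count_predT size_zrange iter_addr_0.
Qed.

End LowMoment.

(** The two contributions carry the powers (M - 1) e and k + (M - d) + 1 of N. With s = M e + b,
    both equal s - (d + 1): the first because e + b = d + 1, the second because s = M + 2 + k. *)
Lemma moment_constants (d N M e b k Z : nat) : (0 < N)%N -> (0 < d)%N -> (d <= M)%N ->
  (0 < e)%N -> (e + b = d.+1)%N -> (M * e + b = M.+2 + k)%N ->
  ((8 ^ M * (2 * (N.*2.*2.+1 ^ (M - d) * (d * N.*2.*2.+1 ^ d.-1)))) ^ e * Z +
    8 ^ (M * e + b) * (2 * N.*2.+1 ^ k) * (N.*2.*2.+1 ^ (M - d) * N.*2.+1) <=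
  ((8 ^ M * (2 * d * 5 ^ M.-1)) ^ e * Z +
    8 ^ (M * e + b) * (2 * 3 ^ k) * (5 ^ (M - d) * 3)) * N ^ (M * e + b - d.+1))%N.
Proof.
move=> N0 d0 dM e0 be sE.
have q5 : (N.*2.*2.+1 <= 5 * N)%N by clear -N0; lia.
have V3 : (N.*2.+1 <= 3 * N)%N by clear -N0; lia.
have powle x y i : (x <= y)%N -> (x ^ i <= y ^ i)%N.
  by case: i => // i xy; rewrite leq_exp2r.
rewrite [X in (_ <= X)%N]mulnDl; apply: leq_add.
  have -> : (M * e + b - d.+1 = M.-1 * e)%N by clear -be dM d0; nia.
  rewrite [X in (_ <= X)%N]mulnAC leq_mul // expnM -expnMn powle //.
  rewrite -[X in (_ <= X)%N]mulnA leq_mul // -[X in (_ <= X)%N]mulnA -mulnA leq_mul //.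
  rewrite mulnCA -expnD (_ : (M - d + d.-1 = M.-1)%N); last by clear -dM d0; lia.
  by rewrite leq_mul // -expnMn powle.
have -> : (M * e + b - d.+1 = k + (M - d) + 1)%N by rewrite sE; clear -dM d0; lia.
rewrite !expnD expn1.
rewrite (_ : 8 ^ _ * 8 ^ _ * (2 * 3 ^ k) * (5 ^ (M - d) * 3) * (N ^ k * N ^ (M - d) * N) =
  8 ^ (M * e) * 8 ^ b * (2 * (3 ^ k * N ^ k)) * ((5 ^ (M - d) * N ^ (M - d)) * (3 * N)))%N.
  by rewrite -!expnMn !leq_mul // powle.
move: (8 ^ _)%N (8 ^ _)%N (3 ^ _)%N (5 ^ _)%N (N ^ k)%N (N ^ _)%N; clear; move=> *; ring.
Qed.

Lemma grid_moment d : (2 < d)%N -> exists K : nat,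
  forall (C : numClosedFieldType) (m : nat) (w : C) (a : int -> C) (N D : nat),
  m.-primitive_root w -> (0 < N)%N ->
  divisor_bound ((4 * N) ^ d) D -> (((4 * N) ^ d).*2 < m)%N ->
  \sum_(z : 'I_m * 'I_m) `|grid_sum w a d N z| ^+ (2 * half_p0 d) <=
    (K * N ^ (half_p0 d - d.+1) * D ^ d.-1)%:R * (m%:R ^+ 2 * mass a N ^+ half_p0 d).
Proof.
move=> d2; have s_gt := half_p0_gt d2.
set s := half_p0 d in s_gt *; set b := low_exp d; set e := low_mult d; set M := (2 ^ d.-1)%N.
pose k := (s - M.+2)%N; have k0 : (0 < k)%N by rewrite subn_gt0.
have sE : (M * e + b = M.+2 + k)%N by rewrite -[LHS]/s /k subnKC // ltnW.
have be : (e + b = d.+1)%N by rewrite /e /low_mult subnK // /b /low_exp; case: odd; lia.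
have Md : (d <= M)%N.
  by rewrite /M -[X in (X <= _)%N](ltn_predK d2); exact: ltn_expl.
have M0 : (0 < M)%N by rewrite /M expn_gt0.
exists ((8 ^ M * (2 * d * 5 ^ M.-1)) ^ e * (d + 3 ^ 7) +
  8 ^ s * (2 * 3 ^ k) * (5 ^ (M - d) * 3))%N.
move=> C m w a N D mw N0 hD Bm.
set q := N.*2.*2.+1.
(* If the mass is 0, F vanishes on the grid; otherwise |F|^2 may be divided by the mass. *)
have [A0|A0] := eqVneq (mass a N) 0.
  have s0 : (0 < s)%N by apply: leq_ltn_trans s_gt.
  rewrite A0 expr0n gtn_eqF // !mulr0 big1 // => z _.
  have := grid_sum_le mw a d N z; rewrite A0 mulr0 => F0.
  have {}F0 : `|grid_sum w a d N z| ^+ 2 = 0 by apply/le_anti; rewrite F0 exprn_ge0.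
  by rewrite exprM F0 expr0n gtn_eqF.
have Agt0 : 0 < mass a N by rewrite lt_def A0 mass_ge0.
pose v (z : 'I_m * 'I_m) : C := `|grid_sum w a d N z| ^+ 2 / mass a N.
have v0 z : 0 <= v z by rewrite divr_ge0 ?exprn_ge0 ?mass_ge0.
have vX i : \sum_z v z ^+ i =
    (\sum_(z : 'I_m * 'I_m) `|grid_sum w a d N z| ^+ (2 * i)) / mass a N ^+ i.
  by rewrite mulr_suml; apply: eq_bigr => z _; rewrite expr_div_n -exprM.
(* [X] is 2 tau, so that X <= 2^(i M) is the condition of [level_set] at L = 2^i. [W1] comes from
   the low moment and [W2] from the level sets. *)
pose X := (2 * (q ^ (M - d) * (d * q ^ d.-1)))%N.
pose W1 : C := ((d + 3 ^ 7) * D ^ d.-1)%:R * m%:R ^+ 2.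
pose W2 : C := (q ^ (M - d) * (N.*2.+1 * D ^ d.-1))%:R * m%:R ^+ 2.
have X0 : (0 < X)%N by rewrite /X !muln_gt0 !expn_gt0 /=; lia.
have hv z : v z <= (N.*2.+1)%:R by rewrite ler_pdivrMr // grid_sum_le.
have hW1 : \sum_z v z ^+ b <= W1.
  by rewrite vX ler_pdivrMr ?exprn_gt0 // -mulrA low_moment.
have W20 : 0 <= W2 by rewrite mulr_ge0 ?exprn_ge0.
have hW2 i : (X <= 2 ^ (i * M))%N ->
     (2 ^ i)%:R ^+ M.+2 * #|[pred z | (4 * 2 ^ i)%:R <= v z]|%:R <= W2.
  move=> Xi; apply: (level_set mw d2 N0 hD Bm Agt0).
  - by rewrite ltr0n expn_gt0.
  - by rewrite -natrX -expnM -mulrnA ler_nat mulnC.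
  - move=> z; rewrite inE /v ler_pdivlMr // => /(le_trans _); apply.
    by rewrite mulrC -mulrnA mulnC.
have := weak_to_strong X0 M0 k0 sE v0 hv hW1 W20 hW2.
rewrite vX ler_pdivrMr ?exprn_gt0 // => /le_trans; apply.
rewrite mulrA -/s ler_wpM2r ?exprn_ge0 ?mass_ge0 //.
have m20 : 0 <= m%:R ^+ 2 :> C by rewrite exprn_ge0.
rewrite /W1 /W2; move: (m%:R ^+ 2) m20 => m2 m20.
rewrite !mulrA -!natrM -mulrDl -natrD ler_wpM2r // ler_nat.
have e0 : (0 < e)%N by rewrite /e /low_mult /low_exp; clear -d2; case: odd; lia.
apply: leq_trans (leq_mul (moment_constants (d + 3 ^ 7) N0 (ltnW (ltnW d2)) Md e0 be sE)
  (leqnn (D ^ d.-1)%N)).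
by rewrite [X in (_ <= X)%N]mulnDl !mulnA.
Qed.

(** * Quadrature on the torus *)

Section Expi.
Variable R : realType.
Implicit Types u v : R.

Lemma expiD u v : expi (u + v) = expi u * expi v.
Proof.
rewrite /expi mulrDr cosD sinD; apply/eqP; rewrite eq_complex /= eqxx /=.
by rewrite addrC mulrC [X in _ + X]mulrC eqxx.
Qed.

Lemma expi0 : expi (0 : R) = 1.
Proof. by rewrite /expi mulr0 cos0 sin0. Qed.

Lemma expiMn u n : expi (u * n%:R) = expi u ^+ n.
Proof.
elim: n => [|n IH]; first by rewrite mulr0 expi0.
by rewrite -addn1 natrD mulrDr mulr1 expiD IH exprD.
Qed.

Lemma expi1 : expi (1 : R) = 1.
Proof. by rewrite /expi mulr1 mulr_natl cos2pi sin2pi. Qed.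

Lemma expi_neq0 u : expi u != 0.
Proof.
have : expi u * expi (- u) = 1 by rewrite -expiD subrr expi0.
by apply: contra_eq_neq => ->; rewrite mul0r eq_sym oner_neq0.
Qed.

Lemma expiN u : expi (- u) = (expi u)^-1.
Proof.
apply: (mulfI (expi_neq0 u)); rewrite -expiD subrr expi0 mulfV //.
exact: expi_neq0.
Qed.

Lemma expiMz u (k : int) : expi (u * k%:~R) = expi u ^ k.
Proof.
case: k => n; first by rewrite expiMn.
by rewrite NegzE mulrNz mulrN expiN expiMn exprnN.
Qed.

Lemma expi_int (k : int) : expi (k%:~R : R) = 1.
Proof. by rewrite -[k%:~R]mul1r expiMz expi1 exp1rz. Qed.

Lemma prim_root_expi (m : nat) : (0 < m)%N -> m.-primitive_root (expi (m%:R^-1 : R)).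
Proof.
move=> m0; rewrite /primitive_root_of_unity m0; apply/forallP => j; apply/eqP.
rewrite unity_rootE -expiMn; have [->|jm] := eqVneq j.+1 m.
  by rewrite mulVf ?pnatr_eq0 -?lt0n // expi1 eqxx.
apply/negbTE/negP => /eqP; rewrite /expi => -[c1 _].
have jm' : (j.+1 < m)%N by rewrite ltn_neqAle jm ltn_ord.
(* This angle lies strictly between 0 and pi, while cos (2x) = 1 would force sin x = 0. *)
pose x : R := pi * (m%:R^-1 * j.+1%:R).
have : 0 < sin x.
  apply: sin_gt0_pi; apply/andP; split.
    by rewrite !mulr_gt0 ?pi_gt0 ?invr_gt0 ?ltr0n.
  by rewrite gtr_pMr ?pi_gt0 // mulrC ltr_pdivrMr ?ltr0n // mul1r ltr_nat.
move: c1; rewrite -mulrA -/x mulr_natl cos_mulr2n => c1 s0.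
have := cos2Dsin2 x; move: s0 c1; move: (sin x) (cos x) => a b; nra.
Qed.

Lemma Re_sum (T : Type) (s : seq T) (f : T -> R[i]) :
  complex.Re (\sum_(i <- s) f i) = \sum_(i <- s) complex.Re (f i).
Proof.
elim: s => [|i s IH]; first by rewrite !big_nil.
by rewrite !big_cons -IH; case: (f i) (\sum_(j <- s) f j) => a b [c d].
Qed.

(** The primitive is explicit, and periodicity makes its increment over [0, 1] vanish unless k = 0.
    Taking real parts brings this under the calculus of real functions. *)
Lemma is_derive_Re_expi (c : R[i]) (k : int) : exists2 H : R -> R,
  forall x : R, is_derive x (1 : R) H (complex.Re (c * expi (x * k%:~R))) &
  H 1 - H 0 = complex.Re (if k == 0 then c else 0).
Proof.
case: c => a b; have [->|k0] := eqVneq k 0.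
  exists (fun x => a * x); last by rewrite mulr1 mulr0 subr0.
  move=> x; rewrite mulr0 expi0 mulr1 /=.
  by apply: is_derive_eq; rewrite /GRing.scale /= mulr1.
pose y := 2 * pi * k%:~R : R.
have y0 : y != 0 by rewrite !mulf_neq0 ?intr_eq0 ?pnatr_eq0 // gt_eqF // pi_gt0.
exists (fun x => a * y^-1 * sin (y * x) + b * y^-1 * cos (y * x)).
  move=> x; apply: is_derive_eq; rewrite /expi /=.
  have -> : y * x = 2 * pi * (x * k%:~R) by rewrite /y; ring.
  by rewrite /GRing.scale /=; field.
have := expi_int k; rewrite /expi -/y => -[c1 s1].
by rewrite !mulr1 !mulr0 cos0 sin0 c1 s1 !mulr0 !add0r subrr.
Qed.

Definition trig_poly (s : seq (R[i] * int)) (x : R) : R[i] :=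
  \sum_(i <- s) i.1 * expi (x * i.2%:~R).

Lemma primitive_trig_poly (s : seq (R[i] * int)) : exists2 H : R -> R,
  forall x : R, is_derive x (1 : R) H (complex.Re (trig_poly s x)) &
  H 1 - H 0 = complex.Re (\sum_(i <- s | i.2 == 0) i.1).
Proof.
elim: s => [|[c k] s [H dH HE]].
  exists (cst 0); last by rewrite big_nil /= subrr.
  by move=> x; rewrite /trig_poly big_nil; exact: is_derive_cst.
have [G dG GE] := is_derive_Re_expi c k.
have ReD (u v : R[i]) : complex.Re (u + v) = complex.Re u + complex.Re v.
  by case: u v => [a b] [c' d].
exists (G + H).
  by move=> x; rewrite /trig_poly big_cons ReD; exact: is_deriveD.
rewrite big_cons /= opprD addrACA GE HE; case: eqP => _; rewrite ?ReD //.
by rewrite add0r.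
Qed.

Lemma trig_poly_average (s : seq (R[i] * int)) (m : nat) : (0 < m)%N ->
  (forall i, i \in s -> (absz i.2 < m)%N) ->
  \sum_(j < m) trig_poly s (j%:R / m%:R) = m%:R * \sum_(i <- s | i.2 == 0) i.1.
Proof.
move=> m0 hs; rewrite exchange_big [in RHS]big_mkcond mulr_sumr big_seq [RHS]big_seq.
apply: eq_bigr => i si; rewrite -mulr_sumr.
under eq_bigr => j _ do rewrite -mulrA mulrC -mulrA -[j%:R]/((j : nat)%:Z%:~R) -intrM expiMz.
rewrite (sum_prim_expz (prim_root_expi m0)).
rewrite dvdzE absz_nat; have := hs i si.
have [->|i0] := eqVneq i.2 0; first by rewrite absz0 dvdn0 mulrC.
by move=> im; rewrite gtnNdvd ?absz_gt0 // !mulr0.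
Qed.

Lemma continuous_Re_trig_poly (s : seq (R[i] * int)) :
  continuous (fun x : R => complex.Re (trig_poly s x)).
Proof.
elim: s => [|[ [a b] k] s IH].
  by move=> x; rewrite /trig_poly; under eq_fun do rewrite big_nil; exact: cvg_cst.
have -> : (fun x : R => complex.Re (trig_poly (((a +i* b)%C, k) :: s) x)) =
    (fun x => a * cos (2 * pi * (x * k%:~R)) - b * sin (2 * pi * (x * k%:~R))) \+
    (fun x => complex.Re (trig_poly s x)).
  apply/funext => x; rewrite {1}/trig_poly big_cons -/(trig_poly s x) /=.
  by case: (trig_poly s x) => u v.
move=> x; apply: continuousD; last exact: IH.
apply: differentiable_continuous; apply/derivable1_diffP.
exact: ex_derive.
Qed.

(** Both sides are the real part of the coefficient at frequency 0: the integral through the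
    primitive, the average because no other frequency of absolute value below m is divisible by
    m. *)
Lemma quadrature (s : seq (R[i] * int)) (m : nat) (h : R -> R) : (0 < m)%N ->
  (forall i, i \in s -> (absz i.2 < m)%N) ->
  (forall x, h x = complex.Re (trig_poly s x)) -> (forall x, 0 <= h x) ->
  (\int[torus_measure R]_x (h x)%:E = (m%:R^-1 * \sum_(j < m) h (j%:R / m%:R))%:E)%E.
Proof.
move=> m0 hs hE h0.
have [H dH HE] := primitive_trig_poly s.
have ch : continuous h.
  by rewrite (_ : h = fun x => complex.Re (trig_poly s x));
    [exact: continuous_Re_trig_poly | apply/funext].
have cH : continuous H.
  move=> x; apply: differentiable_continuous; apply/derivable1_diffP.
  by have ? := dH x; exact: ex_derive.
rewrite integral_uniform //=; last first.
  by apply/measurable_EFinP; exact: continuous_measurable_fun.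
rewrite subr0 invr1 mul1e.
rewrite (@continuous_FTC2 _ h H) //.
- rewrite -EFinB HE; congr EFin.
  under eq_bigr do rewrite hE.
  rewrite -Re_sum trig_poly_average //.
  case: (\sum_(i <- s | _) _) => a b.
  have -> : (m%:R : R[i]) = (m%:R : R)%:C%C by rewrite rmorph_nat.
  by rewrite /= mul0r subr0 mulKf // pnatr_eq0 -lt0n.
- exact: continuous_subspaceT.
- split; first by move=> x _; have ? := dH x; exact: ex_derive.
  + by apply: cvg_at_right_filter; exact: cH.
  + by apply: cvg_at_left_filter; exact: cH.
- by move=> x _; rewrite derive1E hE; have ? := dH x; exact: derive_val.
Qed.
End Expi.

(** * Trigonometric polynomials of bounded degree *)

Section TrigDegree.
Variable R : realType.
Implicit Types f g : R -> R[i].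

Definition trig_deg (B : nat) f := exists2 s : seq (R[i] * int),
  (forall i, i \in s -> (absz i.2 <= B)%N) & f =1 trig_poly s.

Lemma trig_deg_expi (B : nat) (c : R[i]) (k : int) : (absz k <= B)%N ->
  trig_deg B (fun x => c * expi (x * k%:~R)).
Proof.
move=> kB; exists [:: (c, k)]; last by move=> x; rewrite /trig_poly big_seq1.
by move=> i; rewrite inE => /eqP ->.
Qed.

Lemma trig_deg0 B : trig_deg B (fun=> 0).
Proof. by exists [::] => // x; rewrite /trig_poly big_nil. Qed.

Lemma trig_degD B f g : trig_deg B f -> trig_deg B g -> trig_deg B (fun x => f x + g x).
Proof.
move=> [s sB fE] [t tB gE]; exists (s ++ t) => [i|x].
  by rewrite mem_cat => /orP[/sB|/tB].
by rewrite /trig_poly big_cat fE gE.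
Qed.

Lemma trig_deg_sum B (I : Type) (r : seq I) (F : I -> R -> R[i]) :
  (forall i, trig_deg B (F i)) -> trig_deg B (fun x => \sum_(i <- r) F i x).
Proof.
move=> hF; elim: r => [|i r IH].
  by have [s sB sE] := trig_deg0 B; exists s => // x; rewrite big_nil -sE.
by have [s sB sE] := trig_degD (hF i) IH; exists s => // x; rewrite big_cons -sE.
Qed.

Lemma trig_degM B1 B2 f g : trig_deg B1 f -> trig_deg B2 g ->
  trig_deg (B1 + B2) (fun x => f x * g x).
Proof.
move=> [s sB fE] [t tB gE].
exists [seq (i.1 * j.1, i.2 + j.2) | i <- s, j <- t] => [k|x].
  by move=> /allpairsP[[i j] [/= /sB + /tB + ->]] /=; move: i.2 j.2 => k1 k2; lia.
rewrite /trig_poly big_allpairs_dep fE gE mulr_suml; apply: eq_bigr => i _.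
rewrite mulr_sumr; apply: eq_bigr => j _ /=.
by rewrite mulrACA -expiD -mulrDr -intrD.
Qed.

Lemma trig_degX B f n : trig_deg B f -> trig_deg (n * B) (fun x => f x ^+ n).
Proof.
move=> fB; elim: n => [|n IH].
  have [s sB sE] := @trig_deg_expi 0 1 0 isT.
  by exists s => // x; rewrite -sE mulr0 expi0 mulr1.
have [s sB sE] := trig_degM fB IH; rewrite mulSn.
by exists s => // x; rewrite exprS -sE.
Qed.

Lemma expi_conj (u : R) : (expi u)^*%C = expi (- u).
Proof. by rewrite /expi mulrN cosN sinN. Qed.

Lemma trig_deg_conj B f : trig_deg B f -> trig_deg B (fun x => (f x)^*%C).
Proof.
move=> [s sB fE]; exists [seq ((i.1)^*%C, - i.2) | i <- s] => [k|x].
  by move=> /mapP[i /sB iB ->] /=; rewrite abszN.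
rewrite fE /trig_poly big_map rmorph_sum; apply: eq_bigr => i _ /=.
by rewrite rmorphM /= mulrNz mulrN -expi_conj.
Qed.

Lemma trig_deg_quadrature B (m : nat) f (h : R -> R) : (B < m)%N -> trig_deg B f ->
  (forall x, h x = complex.Re (f x)) -> (forall x, 0 <= h x) ->
  (\int[torus_measure R]_x (h x)%:E = (m%:R^-1 * \sum_(j < m) h (j%:R / m%:R))%:E)%E.
Proof.
move=> Bm [s sB fE] hE h0; apply: (@quadrature _ s) => //.
- by apply: leq_ltn_trans Bm.
- by move=> i /sB iB; apply: leq_ltn_trans Bm.
- by move=> x; rewrite hE fE.
Qed.

End TrigDegree.

(** * Even moments on the torus as grid averages *)

Section TorusMoment.
Variables (R : realType) (d N : nat) (a : int -> R[i]).
Local Notation F := (exp_sum d N a).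
Local Notation nrm := (@Normc.normc R).

(** |F|^(2s) written as a trigonometric polynomial in each variable; this is where an even exponent
    matters. *)
Definition moment_poly (s : nat) (z : R * R) : R[i] := F z ^+ s * (F z)^*%C ^+ s.

Lemma moment_polyE s z : nrm (F z) ^+ (2 * s) = complex.Re (moment_poly s z).
Proof.
rewrite /moment_poly -exprMn -sqr_normc -exprM.
have -> : `|F z| = (nrm (F z))%:C%C by [].
by rewrite -rmorphXn.
Qed.

Lemma freq_bound (i : 'I_N.*2.+1) : (absz (freq i) <= N)%N.
Proof. by have := ltn_ord i; rewrite /freq; lia. Qed.

Lemma freqX_bound (i : 'I_N.*2.+1) : (absz (freq i ^+ d) <= N ^ d)%N.
Proof.
rewrite abszX; case: (d) => // e; rewrite leq_exp2r //; exact: freq_bound.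
Qed.

Lemma trig_deg_ext B (f g : R -> R[i]) : f =1 g -> trig_deg B f -> trig_deg B g.
Proof. by move=> fg [s sB sE]; exists s => // x; rewrite -fg. Qed.

Lemma trig_deg_fst t : trig_deg N (fun x => F (x, t)).
Proof.
apply: trig_deg_sum => i.
apply: (@trig_deg_ext _ (fun x => (a (freq i) * expi (t * (freq i)%:~R ^+ d))
   * expi (x * (freq i)%:~R))).
  by move=> x; rewrite -mulrA -expiD.
exact/trig_deg_expi/freq_bound.
Qed.

Lemma trig_deg_snd x : trig_deg (N ^ d) (fun t => F (x, t)).
Proof.
apply: trig_deg_sum => i.
apply: (@trig_deg_ext _ (fun t => (a (freq i) * expi (x * (freq i)%:~R))
   * expi (t * (freq i ^+ d)%:~R))).
  by move=> t; rewrite -mulrA -expiD addrC rmorphXn.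
exact/trig_deg_expi/freqX_bound.
Qed.

Lemma trig_deg_moment_fst s t : trig_deg (2 * s * N) (fun x => moment_poly s (x, t)).
Proof.
rewrite -mulnA mul2n -addnn; apply: trig_degM; apply: trig_degX.
  exact: trig_deg_fst.
exact/trig_deg_conj/trig_deg_fst.
Qed.

Lemma trig_deg_moment_snd s x : trig_deg (2 * s * N ^ d) (fun t => moment_poly s (x, t)).
Proof.
rewrite -mulnA mul2n -addnn; apply: trig_degM; apply: trig_degX.
  exact: trig_deg_snd.
exact/trig_deg_conj/trig_deg_snd.
Qed.

Lemma exp_sum_norm2 z : nrm (F z) ^+ 2 =
  (\sum_(i < N.*2.+1) complex.Re (a (freq i) *
     expi (z.2 * (freq i)%:~R ^+ d + z.1 * (freq i)%:~R))) ^+ 2 +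
  (\sum_(i < N.*2.+1) complex.Im (a (freq i) *
     expi (z.2 * (freq i)%:~R ^+ d + z.1 * (freq i)%:~R))) ^+ 2.
Proof.
have ImE (T : Type) (r : seq T) (f : T -> R[i]) :
    complex.Im (\sum_(i <- r) f i) = \sum_(i <- r) complex.Im (f i).
  elim: r => [|i r IH]; first by rewrite !big_nil.
  by rewrite !big_cons -IH; case: (f i) (\sum_(j <- r) f j) => u v [u' v'].
rewrite -Re_sum -ImE -/(exp_sum d N a z); case: (F z) => u v /=.
by rewrite sqr_sqrtr // addr_ge0 // sqr_ge0.
Qed.

Lemma measurable_norm2 : measurable_fun setT (fun z => nrm (F z) ^+ 2).
Proof.
under eq_fun do rewrite exp_sum_norm2.
have mth (i : 'I_N.*2.+1) : measurable_fun setT (fun z : R * R =>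
    2 * pi * (z.2 * (freq i)%:~R ^+ d + z.1 * (freq i)%:~R) : R).
  apply: measurable_funM => //; apply: measurable_funD; apply: measurable_funM => //.
have mc (i : 'I_N.*2.+1) : measurable_fun setT (fun z : R * R =>
    cos (2 * pi * (z.2 * (freq i)%:~R ^+ d + z.1 * (freq i)%:~R)) : R).
  have mcos := continuous_measurable_fun (@continuous_cos R).
  exact: (measurableT_comp mcos (mth i)).
have ms (i : 'I_N.*2.+1) : measurable_fun setT (fun z : R * R =>
    sin (2 * pi * (z.2 * (freq i)%:~R ^+ d + z.1 * (freq i)%:~R)) : R).
  have msin := continuous_measurable_fun (@continuous_sin R).
  exact: (measurableT_comp msin (mth i)).
have ReE (c : R[i]) (u : R) : complex.Re (c * expi u) =
    complex.Re c * cos (2 * pi * u) - complex.Im c * sin (2 * pi * u) by case: c.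
have ImE (c : R[i]) (u : R) : complex.Im (c * expi u) =
    complex.Re c * sin (2 * pi * u) + complex.Im c * cos (2 * pi * u) by case: c.
apply: measurable_funD; apply: measurable_funX; apply: measurable_sum => i.
  by under eq_fun do rewrite ReE; apply: measurable_funB; apply: measurable_funM.
by under eq_fun do rewrite ImE; apply: measurable_funD; apply: measurable_funM.
Qed.

Lemma measurable_exp_sum : measurable_fun setT (fun z => nrm (F z)).
Proof.
have -> : (fun z => nrm (F z)) = Num.sqrt \o (fun z => nrm (F z) ^+ 2).
  apply/funext => z /=; rewrite sqrtr_sqr ger0_norm //.
  by case: (F z) => u v; exact: sqrtr_ge0.
apply: (measurableT_comp _ measurable_norm2).
exact: continuous_measurable_fun (@sqrt_continuous R).
Qed.

Lemma exp_sum_ge0 z : 0 <= nrm (F z).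
Proof. by case: (F z) => u v; exact: sqrtr_ge0. Qed.

Lemma torus_moment (s m : nat) : (2 * s * N ^ d < m)%N -> (0 < d)%N ->
  (\int[torus2_measure R]_z (nrm (F z) ^+ (2 * s))%:E =
   (m%:R ^- 2 * \sum_(j < m) \sum_(k < m)
      nrm (F (j%:R / m%:R, k%:R / m%:R)) ^+ (2 * s))%:E)%E.
Proof.
move=> hm d0.
have m0 : (0 < m)%N by apply: leq_ltn_trans hm.
have hm1 : (2 * s * N < m)%N.
  apply: leq_ltn_trans hm; rewrite leq_mul2l; apply/orP; right.
  by case: (N) => [//|n]; rewrite -{1}(expn1 n.+1) leq_pexp2l.
rewrite /torus2_measure fubini_tonelli1 /=; last 2 first.
- by apply/measurable_EFinP; apply: measurable_funX; exact: measurable_exp_sum.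
- by move=> z; rewrite lee_fin exprn_ge0 // exp_sum_ge0.
rewrite /fubini_F.
under eq_integral => x _.
  rewrite (@trig_deg_quadrature R _ m _ (fun t => nrm (F (x, t)) ^+ (2 * s)) hm
    (trig_deg_moment_snd s x)) //; last 2 first.
  - by move=> t; exact: moment_polyE.
  - by move=> t; rewrite exprn_ge0 // exp_sum_ge0.
  over.
rewrite /=.
(* After Tonelli and quadrature in t, the average over the nodes in t is still a trigonometric
   polynomial in x, of degree at most 2 s N. *)
pose G x := (m%:R^-1 : R)%:C%C * \sum_(k < m) moment_poly s (x, k%:R / m%:R).
have GE x : m%:R^-1 * \sum_(k < m) nrm (F (x, k%:R / m%:R)) ^+ (2 * s) = complex.Re (G x).
  rewrite /G; under eq_bigr do rewrite moment_polyE.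
  by rewrite -Re_sum; case: (\sum_(k < m) _) => u v /=; rewrite mul0r subr0.
have dG : trig_deg (2 * s * N) G.
  have [t tB tE] := trig_degM (@trig_deg_expi R 0 (m%:R^-1)%:C%C 0 isT)
    (trig_deg_sum (index_enum 'I_m) (fun k : 'I_m => trig_deg_moment_fst s (k%:R / m%:R))).
  by exists t => // x; rewrite -tE mulr0 expi0 mulr1.
rewrite (@trig_deg_quadrature R _ m _ _ hm1 dG GE); last first.
  move=> x; rewrite mulr_ge0 ?invr_ge0 // sumr_ge0 // => k _.
  by rewrite exprn_ge0 // exp_sum_ge0.
by rewrite -mulr_sumr mulrA -invfM -expr2.
Qed.

End TorusMoment.

(** * Conclusion *)

Lemma big_zrange (V : nmodType) N (f : int -> V) :
  \sum_(n <- zrange N) f n = \sum_(i < N.*2.+1) f (freq i).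
Proof.
rewrite /zrange -lock big_map -(big_mkord xpredT (fun i => f (i%:Z - N%:Z))).
by rewrite /index_iota subn0.
Qed.

(** [k] is arbitrary, so D = O(B^(1/k)) can be made smaller than any given positive power of N. *)
Lemma divisor_bound_exists (k : nat) : (0 < k)%N -> exists K : nat, forall B : nat,
  (0 < B)%N -> exists2 D, divisor_bound B D & (D ^ k <= K * B)%N.
Proof.
move=> k0; have [C C0 hC] := size_divisors_bound k0.
exists (2 ^ k * C)%N => B B0; exists (\max_(n < B.+1) (size (divisors n)).*2)%N.
  move=> n n0 nB; rewrite -ltnS in nB.
  exact: (leq_bigmax (F := fun n : 'I_B.+1 => (size (divisors n)).*2) (Ordinal nB)).
elim/big_ind : _ => [|x y hx hy|n _]; first by rewrite exp0n.
  by rewrite /maxn; case: ifP.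
rewrite -mul2n expnMn -mulnA leq_mul2l; apply/orP; right.
(* By convention [divisors 0] has one element. *)
have [->|n0] := posnP n; first by rewrite exp1n muln_gt0 C0.
by apply: leq_trans (hC _ n0) _; rewrite leq_mul2l -ltnS ltn_ord orbT.
Qed.

Section GridValues.
Variables (R : realType) (d N : nat) (a : int -> R[i]).
Local Notation F := (exp_sum d N a).
Local Notation nrm := (@Normc.normc R).

Lemma exp_sum_grid (m : nat) (j k : 'I_m) :
  F (j%:R / m%:R, k%:R / m%:R) = grid_sum (expi (m%:R^-1 : R)) a d N (j, k).
Proof.
rewrite /grid_sum big_zrange; apply: eq_bigr => i _; congr (_ * _).
rewrite -expiMz; congr expi; move: (freq i) => n.
rewrite /pairing /= intrD !intrM rmorphXn /= -!pmulrn; ring.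
Qed.

Lemma massE : mass a N = (l2norm N a ^+ 2)%:C%C.
Proof.
rewrite /l2norm sqr_sqrtr; last by rewrite sumr_ge0 // => i _; rewrite sqr_ge0.
rewrite rmorph_sum /mass big_zrange; apply: eq_bigr => i _.
by rewrite rmorphXn.
Qed.

End GridValues.

Lemma torus_moment_bound d : (2 < d)%N -> exists K : nat,
  forall (R : realType) (a : int -> R[i]) (N D : nat), (0 < N)%N ->
  divisor_bound ((4 * N) ^ d) D ->
  (\int[torus2_measure R]_z (Normc.normc (exp_sum d N a z) ^+ (2 * half_p0 d))%:E <=
   ((K * N ^ (half_p0 d - d.+1) * D ^ d.-1)%:R * l2norm N a ^+ (2 * half_p0 d))%:E)%E.
Proof.
move=> d2; have [K hK] := grid_moment d2; exists K => R a N D N0 hD.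
set s := half_p0 d in hK *.
(* A grid fine enough both for the frequency box (4N)^d and for exact quadrature of |F|^(2s). *)
pose m := (((4 * N) ^ d).*2 + 2 * s * N ^ d).+1.
have m1 : (((4 * N) ^ d).*2 < m)%N by rewrite ltnS leq_addr.
have m2 : (2 * s * N ^ d < m)%N by rewrite ltnS leq_addl.
rewrite (torus_moment a m2 (ltnW (ltnW d2))) lee_fin ler_pdivrMl ?exprn_gt0 ?ltr0n //.
have := hK _ m _ a N D (prim_root_expi R (ltn0Sn _)) N0 hD m1.
rewrite massE -/s => h; rewrite -lecR.
have -> : ((\sum_(j < m) \sum_(k < m)
     Normc.normc (exp_sum d N a (j%:R / m%:R, k%:R / m%:R)) ^+ (2 * s))%:C)%C =
    \sum_(z : 'I_m * 'I_m) `|grid_sum (expi (m%:R^-1 : R)) a d N z| ^+ (2 * s).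
  rewrite pair_bigA rmorph_sum; apply: eq_bigr => -[j k] _ /=.
  by rewrite exp_sum_grid rmorphXn.
apply: (le_trans h); rewrite [X in _ <= X]rmorphM [X in _ <= _ * X]rmorphM /=.
rewrite [(l2norm N a ^+ 2)%:C%C]rmorphXn [(m%:R ^+ 2)%:C%C]rmorphXn.
rewrite [(_ ^+ (2 * s))%:C%C]rmorphXn !rmorph_nat /=.
by rewrite mulrCA -exprM.
Qed.

(** * Passing from the exponent p0 to p *)

Section LnormBound.
Variables (R : realType) (d N : nat) (a : int -> R[i]).
Local Notation F := (exp_sum d N a).
Local Notation nrm := (@Normc.normc R).

Lemma normc_expi (u : R) : nrm (expi u) = 1.
Proof. by rewrite /expi /= cos2Dsin2 sqrtr1. Qed.

Lemma l2norm_ge0 : 0 <= l2norm N a.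
Proof. exact: sqrtr_ge0. Qed.

Lemma exp_sum_sup z : nrm (F z) <= (N.*2.+1)%:R `^ 2^-1 * l2norm N a.
Proof.
rewrite powR12_sqrt //; have l0 := l2norm_ge0.
rewrite -(@ler_pXn2r _ 2) ?nnegrE ?exp_sum_ge0 ?mulr_ge0 ?sqrtr_ge0 //.
rewrite exprMn sqr_sqrtr // -lecR.
have := CauchySchwarz_sum (index_enum 'I_N.*2.+1) (fun i => a (freq i))
  (fun i => expi (z.2 * (freq i)%:~R ^+ d + z.1 * (freq i)%:~R)).
rewrite -/(exp_sum d N a z).
have normE (c : R[i]) : `|c| = (nrm c)%:C%C by [].
under [X in _ <= _ * X]eq_bigr do rewrite normE normc_expi expr1n.
rewrite sumr_const card_ord normE -rmorphXn => /le_trans; apply.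
rewrite rmorphM /= -massE /mass big_zrange rmorph_nat mulrC; exact: lexx.
Qed.

(** Interpolation with the supremum: |F|^p is at most sup|F|^(p - 2s) |F|^(2s), and sup|F| is at
    most (2N+1)^(1/2) times the l2 norm. *)
Lemma Lnorm_torus2_le (p Z : R) (s : nat) : 0 <= Z -> (0 < s)%N -> (2 * s)%:R <= p ->
  (\int[torus2_measure R]_z (nrm (F z) ^+ (2 * s))%:E <= (Z * l2norm N a ^+ (2 * s))%:E)%E ->
  (Lnorm_torus2 p F <=
    (((N.*2.+1)%:R `^ ((p - (2 * s)%:R) / 2) * Z) `^ p^-1 * l2norm N a)%:E)%E.
Proof.
move=> Z0 s0 sp hZ; have l0 := l2norm_ge0.
have p0 : 0 < p by apply: lt_le_trans sp; rewrite ltr0n muln_gt0.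
set l := l2norm N a in l0 hZ *; set V : R := (N.*2.+1)%:R.
pose c := V `^ ((p - (2 * s)%:R) / 2) * l `^ (p - (2 * s)%:R).
have c0 : 0 <= c by rewrite mulr_ge0 // powR_ge0.
have le_c z : nrm (F z) `^ p <= c * nrm (F z) ^+ (2 * s).
  rewrite -powR_mulrn ?exp_sum_ge0 // -{1}[p](subrK (2 * s)%:R) powRD; last first.
    by rewrite subrK gt_eqF.
  rewrite ler_wpM2r ?powR_ge0 // /c.
  have -> : (p - (2 * s)%:R) / 2 = 2^-1 * (p - (2 * s)%:R) by rewrite mulrC.
  rewrite powRrM -powRM ?powR_ge0 // ge0_ler_powR ?subr_ge0 ?nnegrE ?exp_sum_ge0 //.
    by rewrite mulr_ge0 ?powR_ge0.
  exact: exp_sum_sup.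
have mF : measurable_fun setT (fun z => nrm (F z)) := measurable_exp_sum d N a.
have hI : (\int[torus2_measure R]_z (nrm (F z) `^ p)%:E <= (c * (Z * l ^+ (2 * s)))%:E)%E.
  apply: (@le_trans _ _ (\int[torus2_measure R]_z (c%:E * (nrm (F z) ^+ (2 * s))%:E))%E).
    apply: ge0_le_integral => //.
    - by move=> z _; rewrite lee_fin powR_ge0.
    - by apply/measurable_EFinP; apply: (measurableT_comp (measurable_powR p) mF).
    - by apply/measurable_EFinP; apply: measurable_funM => //; exact: measurable_funX.
    - by move=> z _; rewrite -EFinM lee_fin.
  rewrite ge0_integralZl ?lee_fin //; last 2 first.
  - by apply/measurable_EFinP; exact: measurable_funX.
  - by move=> z _; rewrite lee_fin exprn_ge0 // exp_sum_ge0.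
  by rewrite [X in (_ <= X)%E]EFinM lee_wpmul2l // lee_fin.
have cE : c * (Z * l ^+ (2 * s)) = V `^ ((p - (2 * s)%:R) / 2) * Z * l `^ p.
  rewrite /c mulrACA; congr (_ * _).
  rewrite -powR_mulrn // -powRD ?subrK //.
  by rewrite gt_eqF.
rewrite cE in hI.
rewrite /Lnorm_torus2 unlock.
under eq_integral do rewrite gee0_abs ?lee_fin ?exp_sum_ge0 // poweR_EFin.
apply: (@le_trans _ _ ((V `^ ((p - (2 * s)%:R) / 2) * Z * l `^ p)%:E `^ p^-1)%E).
  apply: gt0_ler_poweR hI.
  - by rewrite invr_ge0 ltW.
  - by rewrite in_itv /= leey andbT integral_ge0 // => z _; rewrite lee_fin powR_ge0.
  - by rewrite in_itv /= leey andbT lee_fin !mulr_ge0 // powR_ge0.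
rewrite poweR_EFin lee_fin powRM ?powR_ge0 ?mulr_ge0 ?powR_ge0 //.
by rewrite -[(l `^ p) `^ _]powRrM mulfV ?gt_eqF // powRr1.
Qed.
End LnormBound.

Theorem theorem1p5 (R : realType) (d : nat) (hd : (3 <= d)%N)
    (p : R) (hp : (p0 d)%:R <= p) (eps : R) (heps : 0 < eps) :
  exists C : R, forall N : nat, (0 < N)%N ->
    (best_constant d p N
       <= (C * N%:R `^ (2^-1 - (d + 1)%:R / p + eps))%:E)%E.
Proof.
have [K hK] := torus_moment_bound hd.
have s_gt := half_p0_gt hd.
rewrite (p0E hd) in hp.
set s := half_p0 d in hK hp s_gt.
have s_gt0 : (0 < s)%N by apply: leq_ltn_trans s_gt.
have p_gt0 : 0 < p by apply: lt_le_trans hp; rewrite ltr0n muln_gt0.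
have pn0 : p != 0 by rewrite gt_eqF.
have ep : 0 < eps * p by rewrite mulr_gt0.
(* D^k = O(N^d) gives D^(d-1) = O(N^(d(d-1)/k)); this choice of k makes the exponent at most eps
   p. *)
have [k k0 hk] : exists2 k : nat, (0 < k)%N & (d * d)%:R / k%:R <= eps * p.
  have x0 : 0 <= (d * d)%:R / (eps * p) by rewrite divr_ge0 // ltW.
  have hb := archi_boundP x0; set k := Num.bound _ in hb.
  have k0 : (0 < k)%N by rewrite -(ltr0n R); apply: le_lt_trans hb.
  exists k => //; rewrite ler_pdivrMr ?ltr0n // mulrC.
  by move: hb; rewrite ltr_pdivrMr // => /ltW.
have [K2 hD] := divisor_bound_exists k0.
pose c2 : R := (K2 * 4 ^ d)%:R `^ (d.-1%:R / k%:R).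
pose c1 : R := 3 `^ ((p - (2 * s)%:R) / 2) * (K%:R * c2).
exists (c1 `^ p^-1) => N N0.
have [D hDD hDk] := hD ((4 * N) ^ d)%N (ltac:(rewrite expn_gt0 muln_gt0 N0 //)).
pose Z : R := (K * N ^ (s - d.+1) * D ^ d.-1)%:R.
have Z0 : 0 <= Z by [].
apply: (@le_trans _ _ (((N.*2.+1)%:R `^ ((p - (2 * s)%:R) / 2) * Z) `^ p^-1)%:E).
  apply: ereal_inf_lbound.
  exists (((N.*2.+1)%:R `^ ((p - (2 * s)%:R) / 2) * Z) `^ p^-1) => //= a.
  exact: Lnorm_torus2_le (hK R a N D N0 hDD).
rewrite lee_fin.
have N1 : 1 <= N%:R :> R by rewrite ler1n.
have N0' : 0 <= N%:R :> R by [].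
have NR : N%:R != 0 :> R by rewrite pnatr_eq0 -lt0n.
have ND x y : N%:R `^ (x + y) = N%:R `^ x * N%:R `^ y :> R.
  by rewrite powRD // NR implybT.
have DB : (D ^ d.-1)%:R <= c2 * N%:R `^ (eps * p).
  rewrite natrX.
  have -> : D%:R ^+ d.-1 = (D%:R ^+ k) `^ (d.-1%:R / k%:R) :> R.
    rewrite -!powR_mulrn // -powRrM; congr (_ `^ _); rewrite mulrC divfK //.
    by rewrite pnatr_eq0 -lt0n.
  have e0 : 0 <= d.-1%:R / k%:R :> R by rewrite divr_ge0.
  apply: (@le_trans _ _ ((K2 * 4 ^ d * N ^ d)%:R `^ (d.-1%:R / k%:R))).
    by apply: ge0_ler_powR; rewrite ?nnegrE ?exprn_ge0 // -natrX ler_nat -mulnA -expnMn.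
  rewrite natrM powRM // ler_wpM2l ?powR_ge0 //.
  rewrite natrX -powR_mulrn // -powRrM ler_powR //.
  apply: le_trans hk; rewrite mulrA ler_wpM2r ?invr_ge0 // -natrM ler_nat.
  by rewrite leq_mul2l leq_pred orbT.
(* The exponent of N before the p-th root: E = p/2 - (d + 1) + eps p. *)
pose E := (p - (2 * s)%:R) / 2 + ((s - d.+1)%:R + eps * p).
apply: (@le_trans _ _ ((c1 * N%:R `^ E) `^ p^-1)).
  apply: ge0_ler_powR; rewrite ?nnegrE ?invr_ge0 ?(ltW p_gt0) ?mulr_ge0 ?powR_ge0 //.
  rewrite /E !ND /c1.
  have -> : 3 `^ ((p - (2 * s)%:R) / 2) * (K%:R * c2) * (N%:R `^ ((p - (2 * s)%:R) / 2) *
      (N%:R `^ (s - d.+1)%:R * N%:R `^ (eps * p))) =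
    (3 `^ ((p - (2 * s)%:R) / 2) * N%:R `^ ((p - (2 * s)%:R) / 2)) *
     (K%:R * N%:R `^ (s - d.+1)%:R * (c2 * N%:R `^ (eps * p))) by ring.
  rewrite -powRM // ler_pM ?powR_ge0 //.
    apply: ge0_ler_powR; rewrite ?nnegrE ?divr_ge0 ?subr_ge0 ?mulr_ge0 //.
    by rewrite -natrM ler_nat; clear -N0; lia.
  by rewrite /Z !natrM powR_mulrn // natrX ler_wpM2l ?mulr_ge0 ?exprn_ge0.
rewrite powRM ?mulr_ge0 ?powR_ge0 //.
rewrite le_eqVlt; apply/orP; left; apply/eqP; congr (_ * _).
(* Ensures that the natural number subtraction s - (d + 1) is not truncated. *)
have ds : (d.+1 <= s)%N.
  apply: leq_trans (ltnW s_gt); rewrite ltnS; apply: leq_trans (leqnSn _).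
  by rewrite -[X in (X <= _)%N](ltn_predK hd) ltn_expl.
rewrite -powRrM; congr (_ `^ _); rewrite /E natrB // natrM -addn1.
by field.
Qed.
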